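(* Let $\gamma\in(0,1)$, $a=1-2\gamma$, let $m\ge1$, and let $f\in C^{2,\alpha}\big((-1,1)\big)$, for some $\alpha\in(0,1)$, be odd with $f(0)=f(1)=0$ and $f''<0$ in $(0,1)$. Let $u$ be the saddle-shaped solution of $$\operatorname{div}(\lambda^a\nabla u)=0\ \text{ in }\mathbb{R}^{2m+1}_+,\qquad d_\gamma\frac{\partial u}{\partial\nu^a}=f(u)\ \text{ on }\partial\mathbb{R}^{2m+1}_+=\mathbb{R}^{2m},$$ let $u_0$ be the layer solution, and let $U(x,\lambda):=u_0\!\left(\frac{s-t}{\sqrt2},\lambda\right)$ for $x\in\mathbb{R}^{2m}$, $\lambda\ge0$. Then $$|u(x,\lambda)|\le|U(x,\lambda)|=|u_0(\operatorname{dist}(x,\mathscr{C}),\lambda)|\quad\text{for every }(x,\lambda)\in\overline{\mathbb{R}^{2m+1}_+}.$$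
   Context: Notation. $\mathbb{R}^{n+1}_+=\mathbb{R}^n\times(0,+\infty)$ with points $(x,\lambda)$; $\nabla$ and $\operatorname{div}$ are taken in $(x,\lambda)$. $\dfrac{\partial u}{\partial\nu^a}(x):=-\lim_{\lambda\downarrow0}\lambda^a u_\lambda(x,\lambda)$. The constant $d_\gamma>0$ depends only on $\gamma$ and is the one for which $(-\Delta)^\gamma u(\cdot,0)=d_\gamma\,\partial u/\partial\nu^a$ whenever $\operatorname{div}(\lambda^a\nabla u)=0$ in $\mathbb{R}^{n+1}_+$. The same letter denotes a function on $\mathbb{R}^{n+1}_+$ and its trace on $\mathbb{R}^n=\{\lambda=0\}$. The space $C^{2,\alpha}((-1,1))$ has finite norm, so $f,f',f''$ extend continuously to $[-1,1]$. In $\mathbb{R}^{2m}$ write $x=(x',x'')\in\mathbb{R}^m\times\mathbb{R}^m$, $s=|x'|$, $t=|x''|$, $\mathcal{O}=\{s>t\}$; the Simons cone is $\mathscr{C}=\{s=t\}$. A saddle-shaped solution is a bounded (classical) solution $u$, with $|u|<1$, such that: (i) $u$ is doubly radial, i.e. $u=u(s,t,\lambda)$; (ii) $u$ is odd with respect to $\mathscr{C}$, i.e. $u(s,t,\lambda)=-u(t,s,\lambda)$; (iii) $u>0$ in $\mathcal{O}\times[0,+\infty)$. Such a solution exists and is unique. The layer solution $u_0=u_0(x,\lambda)$ is the unique (bounded) solution of: $\operatorname{div}(\lambda^a\nabla u_0)=0$ in $\mathbb{R}^2_+=\mathbb{R}\times(0,+\infty)$; $d_\gamma\,\partial u_0/\partial\nu^a=f(u_0)$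 on $\partial\mathbb{R}^2_+=\mathbb{R}$; $\partial_xu_0>0$ on $\partial\mathbb{R}^2_+=\mathbb{R}$; $u_0(0,0)=0$; $\lim_{x\to\pm\infty}u_0(x,0)=\pm1$. Its existence and uniqueness under the assumptions on $f$ are known. *)

(* Defs.v *)
From HB Require Import structures.
From mathcomp Require Import all_boot all_order all_algebra.
From mathcomp Require Import all_classical all_reals all_analysis.

Set Implicit Arguments.
Unset Strict Implicit.
Unset Printing Implicit Defensive.

Import Order.TTheory GRing.Theory Num.Theory.
Import numFieldNormedType.Exports.

Local Open Scope classical_set_scope.
Local Open Scope ring_scope.

(* The library norm of 'rV[R]_n is the sup norm, so the Euclidean one is
   defined here. *)
Definition enorm (R : realType) (n : nat) (x : 'rV[R]_n) : R :=
  Num.sqrt (\sum_i x 0 i ^+ 2).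

Definition eucl_dist (R : realType) (n : nat) (x : 'rV[R]_n) (A : set 'rV[R]_n) : R :=
  inf [set enorm (x - y) | y in A].

Definition half_space (R : realType) (n : nat) : set ('rV[R]_n * R) :=
  [set p | 0 < p.2].

Definition closed_half_space (R : realType) (n : nat) : set ('rV[R]_n * R) :=
  [set p | 0 <= p.2].

Definition dir_x (R : realType) (n : nat) (i : 'I_n) : 'rV[R]_n * R :=
  (delta_mx 0 i, 0).

Definition dir_l (R : realType) (n : nat) : 'rV[R]_n * R := (0, 1).

(* Meant for an open set A; in finite dimension, continuity of all directional
   derivatives up to order 2 is the class C^2. *)
Definition C2_on (R : realType) (V : normedModType R) (A : set V) (w : V -> R)
    : Prop :=
  forall p, A p ->
    {for p, continuous w} /\
    forall v1 v2 : V,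
      [/\ derivable w p v1, {for p, continuous ('D_v1 w)},
          derivable ('D_v1 w) p v2 & {for p, continuous ('D_v2 ('D_v1 w))}].

(* div (lambda^a grad u) at p, the gradient and the divergence being taken in
   (x, lambda) *)
Definition weighted_div (R : realType) (n : nat) (a : R)
    (u : 'rV[R]_n * R -> R) (p : 'rV[R]_n * R) : R :=
  \sum_(i < n)
     'D_(dir_x R i) (fun q => q.2 `^ a * 'D_(dir_x R i) u q) p
  + 'D_(dir_l R n) (fun q => q.2 `^ a * 'D_(dir_l R n) u q) p.

Definition flux (R : realType) (n : nat) (a : R) (u : 'rV[R]_n * R -> R)
    (x : 'rV[R]_n) (l : R) : R :=
  l `^ a * 'D_(dir_l R n) u (x, l).

(* meaningful when the limit exists, i.e. when [cvg (flux a u x l @[l --> 0^'+])] *)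
Definition conormal (R : realType) (n : nat) (a : R) (u : 'rV[R]_n * R -> R)
    (x : 'rV[R]_n) : R :=
  - lim (flux a u x l @[l --> 0^'+]).

Definition bounded_extension (R : realType) (n : nat) (a : R)
    (u : 'rV[R]_n * R -> R) : Prop :=
  [/\ exists M : R, forall p, closed_half_space p -> `|u p| <= M,
      {within @closed_half_space R n, continuous u},
      C2_on (@half_space R n) u
    & forall p, half_space p -> weighted_div a u p = 0].

Definition bounded_solution (R : realType) (n : nat) (gamma d : R) (f : R -> R)
    (u : 'rV[R]_n * R -> R) : Prop :=
  bounded_extension (1 - 2 * gamma) u /\
  forall x, cvg (flux (1 - 2 * gamma) u x l @[l --> 0^'+]) /\
            d * conormal (1 - 2 * gamma) u x = f (u (x, 0)).

(* Lebesgue integral over R^n as an iterated integral (Fubini-Tonelli): below it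
   is only applied to Borel functions that are nonnegative or absolutely
   integrable. *)
Fixpoint integral_rV (R : realType) (n : nat) : ('rV[R]_n -> \bar R) -> \bar R :=
  match n with
  | 0 => fun F => F 0
  | k.+1 => fun F =>
      (\int[lebesgue_measure]_t
         integral_rV (fun y : 'rV[R]_k => F (row_mx (const_mx t : 'rV_1) y)))%E
  end.

(* The constant making (-Delta)^gamma the Fourier multiplier |xi|^(2 gamma):
   C = (int_(R^n) (1 - cos z_1) / |z|^(n + 2 gamma) dz)^-1, in dimension
   n = k.+1. *)
Definition frac_lap_const (R : realType) (k : nat) (gamma : R) : R :=
  (fine (integral_rV (fun z : 'rV[R]_k.+1 =>
     ((1 - cos (z 0 ord0)) / enorm z `^ (k.+1%:R + 2 * gamma))%:E)))^-1.

Definition truncated_frac_lap (R : realType) (k : nat) (gamma : R)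
    (w : 'rV[R]_k.+1 -> R) (x : 'rV[R]_k.+1) (e : R) : R :=
  frac_lap_const k gamma *
  fine (integral_rV (fun y : 'rV[R]_k.+1 =>
    (if e < enorm (x - y)
     then (w x - w y) / enorm (x - y) `^ (k.+1%:R + 2 * gamma) else 0)%:E)).

(* (-Delta)^gamma w (x) = l, as a principal value *)
Definition is_frac_lap (R : realType) (k : nat) (gamma : R)
    (w : 'rV[R]_k.+1 -> R) (x : 'rV[R]_k.+1) (l : R) : Prop :=
  truncated_frac_lap gamma w x e @[e --> 0^'+] --> l.

(* d = d_gamma.  Boundedness of u selects the extension of its trace: for
   instance u = lambda^(2 gamma) has zero trace but nonzero conormal
   derivative. *)
Definition extension_constant (R : realType) (gamma d : R) : Prop :=
  0 < d /\
  forall (k : nat) (u : 'rV[R]_k.+1 * R -> R),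
    bounded_extension (1 - 2 * gamma) u ->
    C2_on setT (fun x : 'rV[R]_k.+1 => u (x, 0)) ->
    forall x, is_frac_lap gamma (fun y => u (y, 0)) x
                (d * conormal (1 - 2 * gamma) u x).

(* f in C^{2,alpha}((-1,1)) with finite norm, f also denoting the continuous
   extension to [-1, 1]; values outside [-1, 1] are irrelevant. *)
Definition C2alpha (R : realType) (alpha : R) (f : R -> R) : Prop :=
  [/\ {within `[-1, 1], continuous f},
      forall x : R, -1 < x < 1 -> derivable f x 1 /\ derivable (derive1 f) x 1
    & exists K : R,
        (forall x : R, -1 < x < 1 ->
           [/\ `|f x| <= K, `|derive1 f x| <= K & `|derive1n 2 f x| <= K]) /\
        (forall x y : R, -1 < x < 1 -> -1 < y < 1 ->
           `|derive1n 2 f x - derive1n 2 f y| <= K * `|x - y| `^ alpha)].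

Definition radius_s (R : realType) (m : nat) (x : 'rV[R]_(m + m)) : R :=
  enorm (lsubmx x).

Definition radius_t (R : realType) (m : nat) (x : 'rV[R]_(m + m)) : R :=
  enorm (rsubmx x).

Definition simons_cone (R : realType) (m : nat) : set 'rV[R]_(m + m) :=
  [set x | radius_s x = radius_t x].

Definition saddle_solution (R : realType) (m : nat) (gamma d : R) (f : R -> R)
    (u : 'rV[R]_(m + m) * R -> R) : Prop :=
  [/\ bounded_solution gamma d f u,
      forall p, closed_half_space p -> `|u p| < 1,
      forall x y (l : R), 0 <= l ->
        radius_s x = radius_s y -> radius_t x = radius_t y ->
        u (x, l) = u (y, l),
      forall x y (l : R), 0 <= l ->
        radius_s x = radius_t y -> radius_t x = radius_s y ->
        u (x, l) = - u (y, l)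
    & forall x (l : R), 0 <= l -> radius_t x < radius_s x -> 0 < u (x, l)].

Definition on_line (R : realType) (v : R * R -> R) : 'rV[R]_1 * R -> R :=
  fun p => v (p.1 0 0, p.2).

Definition layer_solution (R : realType) (gamma d : R) (f : R -> R)
    (u0 : R * R -> R) : Prop :=
  [/\ bounded_solution gamma d f (on_line u0),
      forall x, derivable (fun z => u0 (z, 0)) x 1 /\
                0 < derive1 (fun z => u0 (z, 0)) x,
      u0 (0, 0) = 0,
      u0 (x, 0) @[x --> +oo] --> (1 : R)
    & u0 (x, 0) @[x --> -oo] --> (-1 : R)].

Definition layer_of_cone (R : realType) (m : nat) (u0 : R * R -> R)
    (p : 'rV[R]_(m + m) * R) : R :=
  u0 ((radius_s p.1 - radius_t p.1) / Num.sqrt 2, p.2).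

(* Main.v *)
Require Import Defs.
From mathcomp Require Import all_boot all_order all_algebra.
From mathcomp Require Import all_classical all_reals all_analysis.
From mathcomp Require Import ring lra.
Import Order.TTheory GRing.Theory Num.Theory.
Import numFieldNormedType.Exports.
Local Open Scope classical_set_scope.
Local Open Scope ring_scope.

Set Implicit Arguments.
Unset Strict Implicit.
Unset Printing Implicit Defensive.

(* All comparisons are made with pointwise second-order information: a function
   is a subsolution at an interior point if, along each coordinate line, it lies
   above a parabola up to o(r^2), the curvatures adding up with the right sign;
   at the boundary it has an expansion w(x,l) = w(x,0) + c l^(2 gamma) +
   o(l^(2 gamma)).  The barrier A|x|^2 - B l^2 + M l^(2 gamma) then plays two
   roles: on large boxes it gives a Phragmen-Lindelof principle, and on a fixed
   box it replaces compactness of translations, since it turns an almost maximum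
   on the boundary into an exact one at a small cost in the flux.

   The layer solution is odd: sliding two layers u, v along each other, the
   smallest t >= 0 with u <= v(. + t) cannot be positive, by the Hopf lemma at a
   contact point and because f decreases near -1 and 1.

   On s >= t and for tau > 0, let G(x,l) = u0((s-t)/sqrt 2 + tau, l), a
   supersolution which is positive on the cone, and let k be the least factor
   >= 1 with u <= k G on l = 0.  If k > 1 then u - k G almost vanishes at some
   boundary point, where u is close to k G and f(k G) < k f(G) by strict
   concavity; the fluxes then contradict the almost maximality.  So k = 1, and
   tau tends to 0. *)

(** * Second-order lower expansions *)

(** Since f is not monotone on (0, 1), a positive maximum of u - U gives no contradiction with the
    boundary condition. What strict concavity and f(0) = 0 do give is that f(y)/y decreases, a
    statement about ratios; hence the factor k.

    The ratio u/U is of the form 0/0 on the cone, and the shift tau cures this: the trace of the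
    shifted layer is at least v(tau, 0) > 0 on s >= t, so 1/v(tau, 0) is an admissible factor, and
    on the cone, at small heights, u - k G stays below a negative constant, so that almost contacts
    take place elsewhere.

    The distance to the cone is not differentiable where x'' = 0, but the comparison needs only a
    bound from one side there; this is why the jets are one-sided.

    The oddness of the layer matters because its definition prescribes the value 0 at the origin
    only, while the comparison on the cone takes place at all heights. *)

Definition lower_jet (R : realType) (h : R -> R) (b c : R) : Prop :=
  forall e : R, 0 < e -> exists2 dl : R, 0 < dl &
    forall r : R, `|r| < dl -> h 0 + b * r + c / 2 * r ^+ 2 - e * r ^+ 2 <= h r.

Lemma derive_eps (R : realType) (h : R -> R) (x d e : R) :
  is_derive x 1 h d -> 0 < e ->
  exists2 dl : R, 0 < dl &
    forall r : R, `|r| < dl -> `|h (x + r) - h x - d * r| <= e * `|r|.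
Proof.
move=> [dh <-] e0.
have /cvgrPdist_le/(_ e e0) := dh.
rewrite -nbhs_nearE => -[dl /= dl0 H].
exists dl => // r rd; have [->|r0] := eqVneq r 0.
  by rewrite addr0 subrr mulr0 subr0 normr0 mulr0.
have := H r; rewrite /ball/= sub0r normrN => /(_ rd r0).
rewrite /derive.
set L := lim _; rewrite [r *: 1]mulr1 (addrC r x) => HL.
have -> : h (x + r) - h x - L * r = - (L - r^-1 *: (h (x + r) - h x)) * r.
  by rewrite /GRing.scale/=; field.
by rewrite normrM normrN ler_wpM2r.
Qed.

Lemma lower_jetD (R : realType) (h k : R -> R) (b c b' c' : R) :
  lower_jet h b c -> lower_jet k b' c' ->
  lower_jet (fun r => h r + k r) (b + b') (c + c').
Proof.
move=> H K e e0; have e20 : 0 < e / 2 by lra.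
have [d1 d10 H1] := H _ e20; have [d2 d20 K1] := K _ e20.
exists (Num.min d1 d2) => [|r]; first by rewrite lt_min d10.
rewrite lt_min => /andP[r1 r2].
have := H1 r r1; have := K1 r r2; nra.
Qed.

Lemma lower_jetZ (R : realType) (h : R -> R) (b c k : R) :
  0 < k -> lower_jet h b c -> lower_jet (fun r => k * h r) (k * b) (k * c).
Proof.
move=> k0 H e e0; have ek0 : 0 < e / k by rewrite divr_gt0.
have [d1 d10 H1] := H _ ek0; exists d1 => // r rd.
rewrite -subr_ge0; have := H1 r rd; rewrite -subr_ge0 => Hr.
have := mulr_ge0 (ltW k0) Hr.
congr (0 <= _); field; lra.
Qed.

Lemma lower_jet_le (R : realType) (h H : R -> R) (b c d : R) :
  0 < d -> H 0 = h 0 -> (forall r : R, `|r| < d -> H r <= h r) ->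
  lower_jet H b c -> lower_jet h b c.
Proof.
move=> d0 H0 Hh HH e e0; have [d1 d10 H1] := HH _ e0.
exists (Num.min d d1) => [|r]; first by rewrite lt_min d0.
rewrite lt_min => /andP[r1 r2]; rewrite -H0.
exact: le_trans (H1 r r2) (Hh r r1).
Qed.

(** For small r of the sign of b the linear term would dominate; once b = 0, a positive c would
    dominate the error. *)
Lemma lower_jet_max (R : realType) (h : R -> R) (b c d : R) :
  0 < d -> lower_jet h b c -> (forall r : R, `|r| < d -> h r <= h 0) ->
  b = 0 /\ c <= 0.
Proof.
move=> d0 H hmax.
have key (e : R) : 0 < e -> exists2 dl : R, 0 < dl &
    forall r : R, `|r| < dl -> b * r + c / 2 * r ^+ 2 - e * r ^+ 2 <= 0.
  move=> e0; have [d1 d10 H1] := H _ e0.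
  exists (Num.min d d1) => [|r]; first by rewrite lt_min d0.
  rewrite lt_min => /andP[r1 r2]; have := H1 r r2; have := hmax r r1; lra.
have b0 : b = 0.
  apply: contrapT => /eqP b0; have nb : 0 < `|b| by rewrite normr_gt0.
  have [dl dl0 K] := key 1 ltr01.
  (* With error constant 1, this [s] makes the quadratic part at most a quarter of the linear part
     [s * |b|]. *)
  pose s := Num.min (dl / 2) (`|b| / (2 * (`|c| + 2))).
  have c2 : 0 < `|c| + 2 by have := normr_ge0 c; lra.
  have s0 : 0 < s by rewrite lt_min !divr_gt0//; lra.
  have sdl : s < dl by rewrite (@le_lt_trans _ _ (dl / 2)) ?ge_min ?lexx//; lra.
  have sb : s * (`|c| + 2) <= `|b| / 2.
    rewrite -ler_pdivlMr// ge_min; apply/orP; right.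
    by rewrite le_eqVlt; apply/orP; left; apply/eqP; field; lra.
  have := K (Num.sg b * s).
  have sg1 : `|Num.sg b| = 1 by rewrite normr_sg b0.
  have sg2 : Num.sg b ^+ 2 = 1 by rewrite sqr_sg b0.
  rewrite normrM sg1 !mul1r gtr0_norm// => /(_ sdl).
  rewrite exprMn sg2 mul1r mulrA [b * _]mulrC -normrEsg.
  have := ler_norm (- c); rewrite normrN => cc.
  have := ler_wpM2l (ltW s0) sb.
  have : 0 <= s ^+ 2 * (`|c| + c) by rewrite mulr_ge0 ?sqr_ge0//; lra.
  have : 0 < s * `|b| by rewrite mulr_gt0.
  lra.
clear -key b0 c; split=> //; rewrite leNgt; apply/negP => c0.
have c40 : 0 < c / 4 by rewrite divr_gt0.
have [dl dl0 K] := key (c / 4) c40.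
have dl20 : 0 < dl / 2 by rewrite divr_gt0.
have dl2 : dl / 2 < dl by lra.
have := K (dl / 2); rewrite gtr0_norm// b0 => /(_ dl2).
apply/negP; rewrite -ltNge.
have : 0 < c / 4 * (dl / 2) ^+ 2 by rewrite mulr_gt0// exprn_gt0.
by lra.
Qed.

(** Only the differentiability of [h1] at 0 is available, so the mean value theorem is applied once,
    to [h] minus the parabola lowered by e r^2: the derivative of this difference has the sign of
    its argument, since 2e exceeds the error e in the expansion of [h1]. *)
Lemma lower_jet_taylor (R : realType) (h h1 : R -> R) (c d : R) :
  0 < d -> (forall r : R, `|r| < d -> is_derive r 1 h (h1 r)) ->
  is_derive (0 : R) (1 : R) h1 c -> lower_jet h (h1 0) c.
Proof.
move=> d0 hd h1d e e0.
have [d1 d10 H] := derive_eps h1d e0.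
exists (Num.min d d1) => [|r]; first by rewrite lt_min d0.
rewrite lt_min => /andP[rd rd1].
pose phi (s : R) := h s - (h1 0 * s + (c / 2 - e) * s ^+ 2).
have dphi (s : R) : `|s| <= `|r| ->
    is_derive s (1 : R) phi (h1 s - (h1 0 + (c - 2 * e) * s)).
  move=> sr; have ? := hd s (le_lt_trans sr rd).
  apply: is_derive_eq; rewrite /GRing.scale/=; lra.
have cphi (s : R) : `|s| <= `|r| -> {for s, continuous phi}.
  move=> /dphi ds; apply: differentiable_continuous.
  by apply/derivable1_diffP; case: ds.
have est (s : R) : `|s| <= `|r| -> `|h1 s - h1 0 - c * s| <= e * `|s|.
  by move=> sr; have := H s (le_lt_trans sr rd1); rewrite add0r.
suff : phi 0 <= phi r by rewrite /phi; lra.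
case: (ltgtP r 0) => [r0|r0|->//].
- rewrite -subr_ge0 -oppr_le0 opprB.
  have [||s] := @MVT _ phi (fun s => h1 s - (h1 0 + (c - 2 * e) * s)) r 0 r0.
  + move=> s; rewrite in_itv/= => /andP[rs s0]; apply: dphi.
    rewrite !ltr0_norm//; lra.
  + apply: continuous_in_subspaceT => s; rewrite inE/= in_itv/= => /andP[rs s0].
    by apply: cphi; rewrite (ltr0_norm r0) ler0_norm//; lra.
  rewrite in_itv/= => /andP[rs s0] Hs.
  have sr : - s <= - r by lra.
  have := est s; rewrite (ltr0_norm s0) (ltr0_norm r0) => /(_ sr).
  rewrite ler_norml => /andP[_ E]; rewrite Hs.
  by rewrite mulr_le0_ge0//; nra.
- rewrite -subr_ge0.
  have [||s] := @MVT _ phi (fun s => h1 s - (h1 0 + (c - 2 * e) * s)) 0 r r0.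
  + move=> s; rewrite in_itv/= => /andP[s0 rs]; apply: dphi.
    rewrite !gtr0_norm//; lra.
  + apply: continuous_in_subspaceT => s; rewrite inE/= in_itv/= => /andP[s0 rs].
    by apply: cphi; rewrite (gtr0_norm r0) ger0_norm//; lra.
  rewrite in_itv/= => /andP[s0 rs] Hs.
  have := est s; rewrite (gtr0_norm s0) (gtr0_norm r0) => /(_ (ltW rs)).
  rewrite ler_norml => /andP[E _]; rewrite Hs.
  by rewrite mulr_ge0//; nra.
Qed.

(** Chain rule for an inner function that is exactly quadratic; for a monotone outer function, a
    general inner one is reduced to this case by a quadratic bound. *)
Lemma lower_jet_comp (R : realType) (h : R -> R) (b c sg kp : R) :
  lower_jet h b c ->
  lower_jet (fun r => h (sg * r + kp / 2 * r ^+ 2)) (b * sg)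
    (c * sg ^+ 2 + b * kp).
Proof.
move=> H e e0.
(* [m] gives |y| <= m |r| for |r| <= 1. The error is shared between [e1], for the jet of [h] at y,
   and [d2], for the higher-order terms dropped when y^2 is replaced by sg^2 r^2; each takes e /
   4. *)
pose m := `|sg| + `|kp| + 1.
have m0 : 1 <= m by rewrite /m; have := normr_ge0 sg; have := normr_ge0 kp; lra.
pose e1 := e / (4 * m ^+ 2).
have m2 : 1 <= m ^+ 2 by rewrite expr2; nra.
have e10 : 0 < e1 by rewrite divr_gt0//; lra.
have e1E : e1 * m ^+ 2 = e / 4 by rewrite /e1; field; nra.
have [d1 d10 H1] := H _ e10.
pose d2 := e / (4 * (`|c| + 1) * m ^+ 2).
have c1 : 0 < `|c| + 1 by have := normr_ge0 c; lra.
have d20 : 0 < d2 by rewrite divr_gt0// mulr_gt0//; nra.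
have d2E : d2 * (`|c| + 1) * m ^+ 2 = e / 4 by rewrite /d2; field; nra.
exists (Num.min 1 (Num.min (d1 / m) d2)) => [|r].
  by rewrite !lt_min ltr01 d20 divr_gt0//; lra.
rewrite !lt_min ltr_pdivlMr; last lra.
move=> /and3P[r1 rd1 rd2].
set y := sg * r + kp / 2 * r ^+ 2.
have yb : `|y| <= m * `|r|.
  rewrite /y (le_trans (ler_normD _ _))//.
  have -> : `|kp / 2 * r ^+ 2| = `|kp| / 2 * `|r| ^+ 2.
    by rewrite normrM normrX normrM (gtr0_norm (x := 2^-1)) ?invr_gt0.
  rewrite normrM /m.
  have := normr_ge0 r; have := normr_ge0 sg; have := normr_ge0 kp.
  move: `|sg| `|kp| `|r| r1 => A B C C1 A0 B0 C0.
  rewrite !mulrDl -addrA lerD2l.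
  have : 0 <= B * C * (1 - C) by rewrite !mulr_ge0// subr_ge0 ltW.
  nra.
have yd : `|y| < d1 by rewrite (le_lt_trans yb)// mulrC.
have h0E : h (sg * 0 + kp / 2 * 0 ^+ 2) = h 0 by congr h; ring.
rewrite h0E; apply: le_trans (H1 y yd).
have ysq : y ^+ 2 <= m ^+ 2 * r ^+ 2.
  by rewrite -exprMn -(real_normK (num_real y)) -(real_normK (num_real (m * r)))
    ler_pXn2r ?nnegrE// normrM (ger0_norm (x:=m)) //; lra.
have y1 : e1 * y ^+ 2 <= e / 4 * r ^+ 2.
  by rewrite -e1E -mulrA ler_wpM2l// ltW.
have y2 : `|y ^+ 2 - sg ^+ 2 * r ^+ 2| <= m ^+ 2 * `|r| * r ^+ 2.
  have -> : y ^+ 2 - sg ^+ 2 * r ^+ 2 =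
    (sg * kp + kp ^+ 2 / 4 * r) * r * r ^+ 2 by rewrite /y; field.
  rewrite normrM [`|r ^+ 2|]ger0_norm ?sqr_ge0// ler_wpM2r ?sqr_ge0//.
  rewrite normrM ler_wpM2r// (le_trans (ler_normD _ _))//.
  have -> : `|kp ^+ 2 / 4 * r| = `|kp| ^+ 2 / 4 * `|r|.
    by rewrite normrM normrM normrX (gtr0_norm (x := 4^-1)) ?invr_gt0.
  rewrite normrM /m.
  have := normr_ge0 r; have := normr_ge0 sg; have := normr_ge0 kp.
  move: `|sg| `|kp| `|r| r1 => A B C C1 A0 B0 C0.
  have : B ^+ 2 / 4 * C <= B ^+ 2 / 4.
    rewrite -{2}[B ^+ 2 / 4]mulr1; apply: ler_wpM2l (ltW C1).
    by rewrite divr_ge0// sqr_ge0.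
  nra.
have c3 : `|c / 2 * (y ^+ 2 - sg ^+ 2 * r ^+ 2)| <= e / 4 * r ^+ 2.
  rewrite normrM; apply: (@le_trans _ _ ((`|c| + 1) * (m ^+ 2 * `|r| * r ^+ 2))).
    apply: ler_pM => //.
    rewrite normrM (gtr0_norm (x := 2^-1)) ?invr_gt0//.
    have := normr_ge0 c; lra.
  rewrite mulrA ler_wpM2r ?sqr_ge0//.
  have -> : e / 4 = (`|c| + 1) * (m ^+ 2 * d2) by rewrite -d2E; ring.
  by rewrite ler_wpM2l ?ler_wpM2l ?sqr_ge0// ltW.
have := c3; rewrite ler_norml => /andP[+ _].
have -> : y = sg * r + kp / 2 * r ^+ 2 by [].
rewrite -/y => c4.
suff : h 0 + b * sg * r + (c * sg ^+ 2 + b * kp) / 2 * r ^+ 2 =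
  h 0 + b * y + c / 2 * (sg ^+ 2 * r ^+ 2) by have := sqr_ge0 r; nra.
by rewrite /y; field.
Qed.

Lemma lower_jet_quad (R : realType) (h : R -> R) (b c : R) :
  (forall r, h r = h 0 + b * r + c / 2 * r ^+ 2) -> lower_jet h b c.
Proof.
move=> H e e0; exists 1 => // r _; rewrite [leRHS]H gerBl.
by rewrite mulr_ge0 ?sqr_ge0// ltW.
Qed.

Lemma is_derive_powR_shift (R : realType) (l z x : R) : 0 < l + x ->
  is_derive x (1 : R) (fun r => (l + r) `^ z) (z * (l + x) `^ (z - 1)).
Proof.
move=> lx; have H1 := is_derive1_powR z lx.
have H2 : is_derive x (1 : R) (fun r : R => l + r) (1 : R).
  by apply: is_derive_eq; rewrite add0r mulr1.
have := @is_derive1_comp _ (fun t => t `^ z) _ x _ _ H1 H2.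
by rewrite mulr1.
Qed.

Lemma lower_jet_powR (R : realType) (k q l : R) : 0 < l ->
  lower_jet (fun r => k * (l + r) `^ q) (k * (q * l `^ (q - 1)))
    (k * (q * ((q - 1) * l `^ (q - 2)))).
Proof.
move=> l0.
have dpow (z x : R) : `|x| < l ->
    is_derive x (1 : R) (fun r => (l + r) `^ z) (z * (l + x) `^ (z - 1)).
  by rewrite ltr_norml => /andP[xl _]; apply: is_derive_powR_shift; lra.
pose h1 x := k * (q * (l + x) `^ (q - 1)).
have -> : k * (q * l `^ (q - 1)) = h1 0 by rewrite /h1 addr0.
apply: (@lower_jet_taylor _ _ h1 _ l l0) => [r rl|].
  have ? := dpow q r rl; apply: is_derive_eq; by rewrite /GRing.scale/=.
have n0 : `|0 : R| < l by rewrite normr0.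
have ? := dpow (q - 1) 0 n0; apply: is_derive_eq.
have e2 : q - 1 - 1 = q - 2 by ring.
by rewrite /GRing.scale/= addr0 e2.
Qed.

Lemma norm_powR_continuous (R : realType) (q : R) : 0 < q ->
  continuous (fun y : R => `|y| `^ q).
Proof.
move=> q0 y; have [->|y0] := eqVneq y 0.
  rewrite /continuous_at normr0 powR0 ?gt_eqF//.
  apply/cvgrPdist_lt => e e0; near=> z.
  rewrite sub0r normrN ger0_norm ?powR_ge0//.
  have -> : e = (e `^ (q^-1)) `^ q.
    by rewrite -powRrM mulVf ?gt_eqF// powRr1// ltW.
  rewrite gt0_ltr_powR ?nnegrE ?powR_ge0//.
  by near: z; apply: cvgr0_norm_lt => //; exact: powR_gt0.
apply: (@continuous_comp R R R (fun z : R => `|z|) (fun t => t `^ q)).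
  exact: (@norm_continuous _ R).
apply: differentiable_continuous; apply/derivable1_diffP.
by apply: derivable_powR; rewrite in_itv/= andbT normr_gt0.
Unshelve. all: by end_near. Qed.

(** The last inequality is l^(-a) div(l^a grad w) >= 0 in nondivergence form at height l = [p.2],
    with jets in place of derivatives. *)
Definition subsol (R : realType) (n : nat) (a : R) (w : 'rV[R]_n * R -> R)
    (p : 'rV[R]_n * R) : Prop :=
  exists (b c : 'I_n -> R) (bl cl : R),
  [/\ forall i, lower_jet (fun r => w (p.1 + r *: delta_mx 0 i, p.2)) (b i) (c i),
      lower_jet (fun r => w (p.1, p.2 + r)) bl cl
    & 0 <= \sum_i c i + cl + a / p.2 * bl].

Lemma subsolD (R : realType) (n : nat) (a : R) (v w : 'rV[R]_n * R -> R) p :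
  subsol a v p -> subsol a w p -> subsol a (fun q => v q + w q) p.
Proof.
move=> [b [c [bl [cl [vx vl vS]]]]] [b' [c' [bl' [cl' [wx wl wS]]]]].
exists (fun i => b i + b' i), (fun i => c i + c' i), (bl + bl'), (cl + cl').
split => [i||]; [exact: lower_jetD|exact: lower_jetD|].
by rewrite big_split/= mulrDr; lra.
Qed.

Lemma subsolZ (R : realType) (n : nat) (a k : R) (w : 'rV[R]_n * R -> R) p :
  0 < k -> subsol a w p -> subsol a (fun q => k * w q) p.
Proof.
move=> k0 [b [c [bl [cl [wx wl wS]]]]].
exists (fun i => k * b i), (fun i => k * c i), (k * bl), (k * cl).
split => [i||]; [exact: lower_jetZ|exact: lower_jetZ|].
rewrite -mulr_sumr; have := mulr_ge0 (ltW k0) wS; congr (0 <= _).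
by rewrite mulrDr mulrDr mulrCA.
Qed.

Lemma continuous_fctD (R : realType) (T : topologicalType) (f g : T -> R) :
  continuous f -> continuous g -> continuous (fun x => f x + g x).
Proof. by move=> cf cg x; apply: cvgD; [exact: cf|exact: cg]. Qed.

Lemma continuous_fctZ (R : realType) (T : topologicalType) (k : R) (f : T -> R) :
  continuous f -> continuous (fun x => k * f x).
Proof. by move=> cf x; apply: cvgM; [exact: cvg_cst|exact: cf]. Qed.

Lemma continuous_fctX (R : realType) (T : topologicalType) (n : nat) (f : T -> R) :
  continuous f -> continuous (fun x => f x ^+ n).
Proof.
move=> cf x; apply: (@continuous_comp _ R R f (fun t => t ^+ n)); first exact: cf.
exact: exprn_continuous.
Qed.

Lemma coord_fst_continuous (R : realType) (n : nat) (i : 'I_n) :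
  continuous (fun p : 'rV[R]_n * R => p.1 0 i).
Proof.
move=> p; apply: (@continuous_comp _ _ _ fst (fun x : 'rV[R]_n => x 0 i)).
  exact: cvg_fst.
exact: coord_continuous.
Qed.

Lemma snd_continuous (R : realType) (n : nat) :
  continuous (fun p : 'rV[R]_n * R => p.2).
Proof. by move=> p; exact: cvg_snd. Qed.

(** The absolute value makes the function continuous on the whole space, across l = 0; for l >= 0 it
    is the plain power. *)
Definition barrier (R : realType) (n : nat) (g : R) (x0 : 'rV[R]_n) (A B M : R)
    (p : 'rV[R]_n * R) : R :=
  A * (\sum_i (p.1 0 i - x0 0 i) ^+ 2) - B * p.2 ^+ 2 + M * `|p.2| `^ (2 * g).

Lemma barrier_continuous (R : realType) (n : nat) (g : R) (x0 : 'rV[R]_n)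
    (A B M : R) : 0 < g -> continuous (barrier g x0 A B M).
Proof.
move=> g0; have cp := @norm_powR_continuous R (2 * g) ltac:(lra).
apply: continuous_fctD; last first.
  apply: continuous_fctZ => p.
  apply: (@continuous_comp _ R R snd (fun y : R => `|y| `^ (2 * g))).
    exact: cvg_snd.
  exact: cp.
apply: continuous_fctD; last first.
  under eq_fun do rewrite -mulNr.
  by apply/continuous_fctZ/continuous_fctX/snd_continuous.
apply/continuous_fctZ/continuous_big => [|i _]; first exact: add_continuous.
apply/continuous_fctX/continuous_fctD; first exact: coord_fst_continuous.
exact: cst_continuous.
Qed.

Definition box (R : realType) (n : nat) (x0 : 'rV[R]_n) (r : R) :
  set ('rV[R]_n * R) :=
  [set p : 'rV[R]_n * R | (forall i, `|p.1 0 i - x0 0 i| <= r) /\ 0 <= p.2 <= r].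

Lemma box_compact (R : realType) (n : nat) (x0 : 'rV[R]_n) (r : R) :
  compact (box x0 r).
Proof.
have -> : box x0 r = [set x : 'rV[R]_n | forall i,
    `[x0 0 i - r, x0 0 i + r]%classic (x ord0 i)] `*` `[0, r]%classic.
  apply/seteqP; split => [p [p1 p2]|p [p1 p2]]; split => //=.
  - by move=> i; rewrite in_itv/= -ler_distl.
  - by move=> i; have := p1 i; rewrite /= in_itv/= -ler_distl.
apply: compact_setX; last exact: segment_compact.
apply: (@rV_compact R n (fun i => `[x0 0 i - r, x0 0 i + r]%classic)) => i.
exact: segment_compact.
Qed.

Lemma compact_closed_argmax (R : realType) (T : topologicalType) (D K : set T)
    (v w : T -> R) (p : T) :
  closed D -> compact K -> {within D, continuous w} -> continuous v ->
  D p -> K p ->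
  exists q, [/\ D q, K q & forall q', D q' -> K q' -> w q' - v q' <= w q - v q].
Proof.
move=> cD cK cw cv Dp Kp.
have [|||q] := @compact_EVT_max _ R (fun q => w q - v q) (K `&` D).
- by exists p.
- exact: compact_closedI.
- move=> x; apply: (@continuousB R R).
    by apply: continuous_subspaceW cw _ => y [].
  exact: continuous_subspaceT.
rewrite inE => -[Kq Dq] H; exists q; split => // q' Dq' Kq'.
by apply: H; rewrite inE.
Qed.

(* With a = 1 - 2g, the function |l|^(2g) is a-harmonic, whereas
   div (l^a grad (A |x - x0|^2 - B l^2)) = 2 l^a (n A - (1 + a) B). *)
Lemma barrier_subsol_no_max (R : realType) (n : nat) (g : R) (x0 : 'rV[R]_n)
    (A B M e : R) (w : 'rV[R]_n * R -> R) (p : 'rV[R]_n * R) :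
  0 < p.2 -> 0 < e -> n%:R * A < (2 - 2 * g) * B -> subsol (1 - 2 * g) w p ->
  (\forall q \near p, w q - e * barrier g x0 A B M q <=
                      w p - e * barrier g x0 A B M p) -> False.
Proof.
case: p => x l /= l0 e0 AB [b [c [bl [cl [wx wl wS]]]]].
move=> /nbhs_ballP[d /= d0 H].
have Hx (i : 'I_n) : b i = e * (2 * A * (x 0 i - x0 0 i)) /\ c i <= e * (2 * A).
  pose k r := - e * barrier g x0 A B M (x + r *: delta_mx 0 i, l).
  have kj : lower_jet k (- e * (2 * A * (x 0 i - x0 0 i))) (- e * (2 * A)).
    apply: lower_jet_quad => r; rewrite /k /barrier/=.
    rewrite (bigD1 i)//= [in RHS](bigD1 i)//= !mxE !eqxx/=.
    have E s : \sum_(j < n | j != i) ((x + s *: delta_mx 0 i) 0 j - x0 0 j) ^+ 2 =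
        \sum_(j < n | j != i) (x 0 j - x0 0 j) ^+ 2.
      apply: eq_bigr => j ji; rewrite !mxE eqxx/= (negbTE ji) mulr0 addr0//.
    by rewrite !E; field.
  have [|bE cE] := lower_jet_max d0 (lower_jetD (wx i) kj).
    move=> r rd; rewrite /k !mulNr scale0r addr0; apply: H.
    split => /=; last exact: ballxx.
    split=> // i' j; rewrite !mxE /ball/= opprD addrA subrr sub0r normrN normrM.
    rewrite (le_lt_trans _ rd)// ler_piMr// normr_nat lern1.
    by case: (_ && _).
  by split; lra.
set P := l `^ (2 * g - 2).
have PE : l `^ (2 * g - 1) = l * P.
  rewrite /P -{2}[l]powRr1 ?ltW// -powRD; last by rewrite (gt_eqF l0) implybT.
  by congr powR; ring.
have [blE clE] : bl = e * (M * (2 * g * (l * P)) - 2 * B * l) /\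
    cl <= e * (M * (2 * g * ((2 * g - 1) * P)) - 2 * B).
  pose S := \sum_i (x 0 i - x0 0 i) ^+ 2.
  have qj : lower_jet (fun r => - e * (A * S - B * (l + r) ^+ 2))
      (2 * e * B * l) (2 * e * B).
    by apply: lower_jet_quad => r; field.
  have kj := lower_jetD qj (lower_jet_powR (- e * M) (2 * g) l0).
  have [||] := @lower_jet_max _ _ _ _ (Num.min l d) _ (lower_jetD wl kj).
  - by rewrite lt_min l0.
  - move=> r; rewrite lt_min => /andP[rl rd].
    have lr : 0 < l + r by move: rl; rewrite ltr_norml; lra.
    have := H (x, l + r); rewrite /barrier/= -/S (gtr0_norm l0) (gtr0_norm lr).
    have inB : ball (x, l) d (x, l + r).
      split; first exact: ballxx.
      by rewrite /ball/= opprD addrA subrr sub0r normrN.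
    by move=> /(_ inB); rewrite addr0; lra.
  by rewrite -/P PE => ? ?; split; lra.
have : \sum_i c i <= n%:R * (e * (2 * A)).
  have -> : n%:R * (e * (2 * A)) = \sum_(i < n) (e * (2 * A)).
    by rewrite sumr_const card_ord mulr_natl.
  by apply: ler_sum => i _; case: (Hx i).
have : (1 - 2 * g) / l * bl =
    (1 - 2 * g) * (e * (M * (2 * g * P) - 2 * B)).
  by rewrite blE; field; lra.
have : 0 < e * ((2 - 2 * g) * B - n%:R * A) by rewrite mulr_gt0// subr_gt0.
by move: wS; lra.
Qed.

(** * Maximum principles *)

(** In the scale r = 1 with A = 1, the barrier is a strict supersolution as soon as B > n/(2 - 2g);
    the added 1 ensures strictness. *)
Definition barrier_coef (R : realType) (n : nat) (g : R) : R :=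
  n%:R / (2 - 2 * g) + 1.

(** The barrier scaled to a box of size r. In the scale r = 1 one has M = B + 1 and l^2 <= l^(2g) on
    [0, 1]: the part B compensates - B l^2, and what remains is at least |x - x0|^2 + l^(2g), hence
    at least 1 on the lateral and top faces. *)
Definition box_barrier (R : realType) (n : nat) (g : R) (x0 : 'rV[R]_n) (r : R) :=
  barrier g x0 (r ^- 2) (barrier_coef n g / r ^+ 2)
    ((barrier_coef n g + 1) / r `^ (2 * g)).

Lemma barrier_coef_gt0 (R : realType) (n : nat) (g : R) :
  g < 1 -> 0 < barrier_coef n g.
Proof. by move=> g1; rewrite ltr_wpDl// divr_ge0//; lra. Qed.

Lemma box_barrier_coefs (R : realType) (n : nat) (g r : R) : g < 1 -> 0 < r ->
  n%:R * r ^- 2 < (2 - 2 * g) * (barrier_coef n g / r ^+ 2).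
Proof.
move=> g1 r0; rewrite mulrA ltr_pM2r ?invr_gt0 ?exprn_gt0//.
have -> : (2 - 2 * g) * barrier_coef n g = n%:R + (2 - 2 * g).
  by rewrite /barrier_coef; field; lra.
by lra.
Qed.

Lemma box_barrier_base (R : realType) (n : nat) (g : R) (x0 : 'rV[R]_n) (r l : R) :
  0 < g < 1 -> 0 < r -> 0 <= l ->
  box_barrier g x0 r (x0, l) <=
  (barrier_coef n g + 1) / r `^ (2 * g) * l `^ (2 * g).
Proof.
move=> /andP[g0 g1] r0 l0; rewrite /box_barrier /barrier/= ger0_norm//.
rewrite big1 => [|i _]; last by rewrite subrr expr0n.
have : 0 <= barrier_coef n g / r ^+ 2 * l ^+ 2.
  by rewrite mulr_ge0 ?divr_ge0 ?sqr_ge0 ?ltW ?barrier_coef_gt0.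
lra.
Qed.

Lemma box_barrier_bounds (R : realType) (n : nat) (g : R) (x0 : 'rV[R]_n)
    (r : R) (p : 'rV[R]_n * R) : 0 < g < 1 -> 0 < r -> box x0 r p ->
  0 <= box_barrier g x0 r p /\
  (box_barrier g x0 r p < 1 -> (forall i, `|p.1 0 i - x0 0 i| < r) /\ p.2 < r).
Proof.
case: p => x l /andP[g0 g1] r0 [/= xr /andP[l0 lr]].
have K0 := @barrier_coef_gt0 R n g g1.
pose t := l / r.
have t0 : 0 <= t by rewrite divr_ge0// ltW.
have t1 : t <= 1 by rewrite ler_pdivrMr// mul1r.
have tE : t `^ (2 * g) = l `^ (2 * g) / r `^ (2 * g).
  by rewrite /t powRM ?invr_ge0 ?(ltW r0)// -powR_inv1 ?(ltW r0)// -powRrM mulN1r powRN.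
have t2 : t ^+ 2 <= t `^ (2 * g).
  move: t0; rewrite le_eqVlt => /predU1P[<-|t0].
    by rewrite expr0n/= powR_ge0.
  rewrite -(powR_mulrn _ (ltW t0)); apply: ger_powR; last lra.
  by rewrite t0 t1.
have lb : \sum_i (x 0 i - x0 0 i) ^+ 2 / r ^+ 2 + t `^ (2 * g) <=
    box_barrier g x0 r (x, l).
  rewrite /box_barrier /barrier/= ger0_norm// mulr_sumr.
  under [in leRHS]eq_bigr do rewrite mulrC.
  have -> : barrier_coef n g / r ^+ 2 * l ^+ 2 = barrier_coef n g * t ^+ 2.
    by rewrite /t; field; lra.
  have -> : (barrier_coef n g + 1) / r `^ (2 * g) * l `^ (2 * g) =
      (barrier_coef n g + 1) * t `^ (2 * g) by rewrite tE; ring.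
  have : 0 <= barrier_coef n g * (t `^ (2 * g) - t ^+ 2).
    by rewrite mulr_ge0 ?subr_ge0// ltW.
  lra.
have S0 : 0 <= \sum_i (x 0 i - x0 0 i) ^+ 2 / r ^+ 2.
  by apply: sumr_ge0 => i _; rewrite divr_ge0 ?sqr_ge0.
have T0 := powR_ge0 t (2 * g).
split=> [|b1]; first lra.
split=> [i|].
- rewrite lt_neqAle xr andbT; apply/eqP => xi.
  move: lb; rewrite (bigD1 i)//= -(real_normK (num_real (_ - _))) xi.
  rewrite divff ?expf_neq0 ?gt_eqF//.
  have : 0 <= \sum_(j < n | j != i) (x 0 j - x0 0 j) ^+ 2 / r ^+ 2.
    by apply: sumr_ge0 => j _; rewrite divr_ge0 ?sqr_ge0.
  lra.
- rewrite lt_neqAle lr andbT; apply/eqP => lrE.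
  have t1E : t = 1 by rewrite /t lrE divff// gt_eqF.
  by move: lb; rewrite t1E powR1; lra.
Qed.

Lemma nbhs_box (R : realType) (n : nat) (x0 : 'rV[R]_n) (r : R) (p : 'rV[R]_n * R) :
  (forall i, `|p.1 0 i - x0 0 i| < r) -> 0 < p.2 < r -> nbhs p (box x0 r).
Proof.
move=> pr /andP[p0 p2].
have H1 : nbhs p [set q : 'rV[R]_n * R | forall i, `|q.1 0 i - x0 0 i| < r].
  apply: (@filter_forall _ 'I_n (fun i (q : 'rV[R]_n * R) => `|q.1 0 i - x0 0 i| < r)
    (nbhs p) (nbhs_filter p)) => i.
  have c : {for p, continuous (fun q : 'rV[R]_n * R => `|q.1 0 i - x0 0 i|)}.
    apply: (@continuous_comp _ R R (fun q : 'rV[R]_n * R => q.1 0 i - x0 0 i)).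
      apply: continuousB; last exact: cst_continuous.
      exact: coord_fst_continuous.
    exact: norm_continuous.
  by apply: (cvgr_lt (`|p.1 0 i - x0 0 i|)); [exact: c|exact: pr].
have H2 : nbhs p [set q : 'rV[R]_n * R | 0 < q.2].
  exact: (@cvgr_gt R _ (nbhs p) (nbhs_filter p) snd p.2 (@snd_continuous R n p) 0 p0).
have H3 : nbhs p [set q : 'rV[R]_n * R | q.2 < r].
  exact: (@cvgr_lt R _ (nbhs p) (nbhs_filter p) snd p.2 (@snd_continuous R n p) r p2).
near=> q; split.
  by move=> i; apply: ltW; move: i; near: q.
by apply/andP; split; apply: ltW; near: q.
Unshelve. all: by end_near. Qed.

(** A positive value dl at (x1, l1) is compared with N times the barrier of a huge box: w is at most
    N, hence below it on the faces, while its value at (x1, l1) is at most dl / 2. A maximum of the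
    difference then lies off the faces at a point where w > 0, and the strict supersolution property
    excludes it. *)
Lemma phragmen_lindelof (R : realType) (n : nat) (g M : R)
    (D : set ('rV[R]_n * R)) (w : 'rV[R]_n * R -> R) : 0 < g < 1 ->
  closed D -> D `<=` @closed_half_space R n -> {within D, continuous w} ->
  (forall p, D p -> w p <= M) ->
  (forall p, D p -> w p <= 0 \/
     [/\ 0 < p.2, nbhs p D & subsol (1 - 2 * g) w p]) ->
  forall p, D p -> w p <= 0.
Proof.
move=> g01 cD Dh cw wM0 Hw [x1 l1] Dp; have /andP[g0 g1] := g01.
rewrite leNgt; apply/negP => wp.
pose N := Num.max M 1.
have N0 : 0 < N by rewrite lt_max ltr01 orbT.
have wM p : D p -> w p <= N by move=> /wM0 H; rewrite le_max H.
have K0 := @barrier_coef_gt0 R n g g1.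
have l10 : 0 <= l1 by exact: (Dh _ Dp).
set dl := w (x1, l1) in wp.
(* [t] solves N (B + 1) t = dl / 2 with B = [barrier_coef n g], and c^(2g) >= 1 / t; for r = (l1 +
   1) c this makes the barrier at (x1, l1) at most (B + 1) t. *)
pose t := dl / (2 * N * (barrier_coef n g + 1)).
have t0 : 0 < t by rewrite divr_gt0// !mulr_gt0//; lra.
pose c := Num.max 1 (t^-1 `^ (2 * g)^-1).
have c1 : 1 <= c by rewrite le_max lexx.
have ct : t^-1 <= c `^ (2 * g).
  have -> : t^-1 = (t^-1 `^ (2 * g)^-1) `^ (2 * g).
    by rewrite -powRrM mulVf ?powRr1 ?invr_ge0 ?ltW//; lra.
  apply: ge0_ler_powR; rewrite ?nnegrE ?powR_ge0//; first lra.
    lra.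
  by rewrite le_max lexx orbT.
pose r := (l1 + 1) * c.
have r0 : 0 < r by rewrite mulr_gt0//; lra.
have lr : l1 <= r by rewrite /r; nra.
have small : N * box_barrier g x1 r (x1, l1) <= dl / 2.
  apply: le_trans (ler_wpM2l (ltW N0) (box_barrier_base x1 g01 r0 l10)) _.
  have rt : l1 `^ (2 * g) <= r `^ (2 * g) * t.
    rewrite /r powRM; [|lra|lra].
    apply: (@le_trans _ _ ((l1 + 1) `^ (2 * g))).
      by apply: ge0_ler_powR; rewrite ?nnegrE; lra.
    rewrite -mulrA ler_peMr ?powR_ge0//.
    by have := ler_wpM2r (ltW t0) ct; rewrite mulVf// gt_eqF.
  have rg : 0 < r `^ (2 * g) by rewrite powR_gt0.
  apply: (@le_trans _ _ (N * ((barrier_coef n g + 1) / r `^ (2 * g) * (r `^ (2 * g) * t)))).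
    apply: (ler_wpM2l (ltW N0)); apply: (ler_wpM2l _ rt).
    by rewrite divr_ge0// ltW//; lra.
  rewrite le_eqVlt; apply/orP; left; apply/eqP; rewrite /t; field.
  by rewrite !gt_eqF//; lra.
have bp : box x1 r (x1, l1) by split => [i|] /=; rewrite ?subrr ?normr0 ?l10 ?lr// ltW.
have cv : continuous (fun p => N * box_barrier g x1 r p).
  by apply: continuous_fctZ; exact: barrier_continuous.
have [q [Dq Bq qmax]] := compact_closed_argmax cD (@box_compact R n x1 r) cw cv Dp bp.
have [b0 b1] := box_barrier_bounds g01 r0 Bq.
have := qmax _ Dp bp; rewrite -/dl => qp.
have Nb : 0 <= N * box_barrier g x1 r q by rewrite mulr_ge0// ltW.
have wq : 0 < w q by lra.
have [|[q0 nD sq]] := Hw q Dq; first lra.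
have bq1 : box_barrier g x1 r q < 1.
  by rewrite -(ltr_pM2l N0) mulr1; have := wM _ Dq; lra.
have [qi ql] := b1 bq1.
apply: (barrier_subsol_no_max q0 N0 (@box_barrier_coefs R n g r g1 r0) sq).
have nB : nbhs q (box x1 r) by apply: nbhs_box => //; rewrite q0.
near=> p; apply: qmax; near: p; [exact: nD|exact: nB].
Unshelve. all: by end_near. Qed.

(** Subtracting [2 * eps] times the barrier produces a maximum off the faces of the box, at a point
    where w > - eps. Interior points being excluded, it lies on l = 0, and going up from it compares
    eta l^(2g) with the barrier. For fixed r, letting eps tend to 0 rules out eta > 0. *)
Lemma boundary_contact (R : realType) (n : nat) (g r eps eta : R) (x0 : 'rV[R]_n)
    (D : set ('rV[R]_n * R)) (w : 'rV[R]_n * R -> R) : 0 < g < 1 ->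
  0 < r -> 0 < eps ->
  closed D -> D `<=` @closed_half_space R n -> {within D, continuous w} ->
  (forall p, D p -> w p <= 0) -> D (x0, 0) -> - eps < w (x0, 0) ->
  (forall p, D p -> box x0 r p -> [\/ w p <= - eps,
     [/\ 0 < p.2, nbhs p D & subsol (1 - 2 * g) w p] |
     p.2 = 0 /\ exists2 d, 0 < d & forall l, 0 < l < d ->
       D (p.1, l) /\ w p + eta * l `^ (2 * g) <= w (p.1, l)]) ->
  eta <= 2 * eps * ((barrier_coef n g + 1) / r `^ (2 * g)).
Proof.
move=> g01 r0 eps0 cD Dh cw w0 Dp wp Hw; have /andP[g0 g1] := g01.
have K0 := @barrier_coef_gt0 R n g g1.
have e0 : 0 < 2 * eps by lra.
have bp : box x0 r (x0, 0).
  by split => [i|] /=; rewrite ?subrr ?normr0 ?lexx ltW.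
have cv : continuous (fun p => 2 * eps * box_barrier g x0 r p).
  by apply: continuous_fctZ; exact: barrier_continuous.
have [q [Dq Bq qmax]] := compact_closed_argmax cD (@box_compact R n x0 r) cw cv Dp bp.
have [b0 b1] := box_barrier_bounds g01 r0 Bq.
have := qmax _ Dp bp.
have : box_barrier g x0 r (x0, 0) <= 0.
  have := box_barrier_base x0 g01 r0 (lexx 0).
  by rewrite powR0 ?mulr0//; lra.
rewrite -(ler_pM2l e0) mulr0 => bx0 qp.
have Nb : 0 <= 2 * eps * box_barrier g x0 r q by rewrite mulr_ge0// ltW.
have wq : - eps < w q by lra.
have bq1 : box_barrier g x0 r q < 1.
  by rewrite -(ltr_pM2l e0) mulr1; have := w0 _ Dq; lra.
have [qi ql] := b1 bq1.
have [|[q0 nD sq]|[q0 [d d0 Hd]]] := Hw q Dq Bq; first lra.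
  exfalso.
  apply: (barrier_subsol_no_max q0 e0 (@box_barrier_coefs R n g r g1 r0) sq).
  have nB : nbhs q (box x0 r) by apply: nbhs_box => //; rewrite q0.
  near=> p; apply: qmax; near: p; [exact: nD|exact: nB].
case: q q0 {Dq wq bq1 b0 b1 qp Nb} Bq qi ql Hd qmax => y l0 /= -> Bq qi _ Hd qmax.
pose l := Num.min d r / 2.
have m0 : 0 < Num.min d r by rewrite lt_min d0.
have l_gt0 : 0 < l by rewrite divr_gt0.
have lm : l < Num.min d r by rewrite /l; lra.
have [ld lr] : l < d /\ l < r by move: lm; rewrite lt_min => /andP.
have [|Dl Hl] := Hd l; first by rewrite l_gt0.
have Bl : box x0 r (y, l).
  by case: Bq => ? _; split => //=; rewrite !ltW.
have := qmax _ Dl Bl.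
rewrite /box_barrier /barrier/= normr0 powR0; last by rewrite gt_eqF//; lra.
rewrite gtr0_norm// => H.
have P0 : 0 < l `^ (2 * g) by rewrite powR_gt0.
rewrite -(ler_pM2r P0).
have : 0 <= 2 * eps * (barrier_coef n g / r ^+ 2 * l ^+ 2).
  by rewrite !mulr_ge0 ?invr_ge0 ?sqr_ge0// ltW.
lra.
Unshelve. all: by end_near. Qed.

(** * Solutions have pointwise expansions *)

Lemma continuous_within_comp (T U V : topologicalType) (A : set T) (D : set U)
    (k : T -> U) (u : U -> V) :
  {within D, continuous u} -> continuous k -> (forall t, A t -> D (k t)) ->
  {within A, continuous (fun t => u (k t))}.
Proof.
move=> /subspace_continuousP cu ck AD; apply/subspace_continuousP => t At.
move=> W /(cu _ (AD _ At)) /ck /= H.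
by apply: (@filterS _ (nbhs t) _ _ _ _ H) => s Hs As; apply: Hs; exact: AD.
Qed.

Lemma continuous_fct_pair (T U V : topologicalType) (f : T -> U) (g : T -> V) :
  continuous f -> continuous g -> continuous (fun t => (f t, g t)).
Proof. by move=> cf cg t; exact: (cvg_pair (cf t) (cg t)). Qed.

Lemma derive_lineE (R : realType) (V : normedModType R) (u : V -> R) (p v : V) (r : R) :
  (fun h : R => h^-1 *: (u (p + (h *: (1 : R) + r) *: v) - u (p + r *: v))) =
  (fun h : R => h^-1 *: (u (h *: v + (p + r *: v)) - u (p + r *: v))).
Proof.
apply/funext => h; congr (h^-1 *: (u _ - _)).
by rewrite scalerDl [h *: 1]mulr1 addrCA.
Qed.

Lemma derivable_line (R : realType) (V : normedModType R) (u : V -> R) (p v : V) (r : R) :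
  derivable u (p + r *: v) v ->
  is_derive r (1 : R) (fun s => u (p + s *: v)) ('D_v u (p + r *: v)).
Proof.
move=> du; split; first by rewrite /derivable derive_lineE.
by rewrite /derive derive_lineE.
Qed.

Lemma is_derive_line (R : realType) (V : normedModType R) (u : V -> R) (p v : V) (d : R) :
  is_derive (0 : R) (1 : R) (fun s => u (p + s *: v)) d -> is_derive p v u d.
Proof.
have pE : p = p + 0 *: v by rewrite scale0r addr0.
move=> [du <-]; split.
  by rewrite pE; move: du; rewrite /derivable derive_lineE.
by rewrite {1}pE /derive derive_lineE.
Qed.

Lemma C2_lower_jet (R : realType) (n : nat) (u : 'rV[R]_n * R -> R)
    (p v : 'rV[R]_n * R) : C2_on (@half_space R n) u -> half_space p ->
  lower_jet (fun r => u (p + r *: v)) ('D_v u p) ('D_v ('D_v u) p) /\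
  lower_jet (fun r => - u (p + r *: v)) (- 'D_v u p) (- 'D_v ('D_v u) p).
Proof.
move=> Cu; rewrite /half_space/= => p0.
pose d := p.2 / (`|v.2| + 1).
have v1 : 0 < `|v.2| + 1 by rewrite ltr_wpDl.
have d0 : 0 < d by rewrite divr_gt0.
have inH r : `|r| < d -> half_space (p + r *: v).
  rewrite /half_space/= ltr_pdivlMr// => rd.
  have : `|r *: v.2| <= `|r| * (`|v.2| + 1).
    by rewrite normrM ler_wpM2l// lerDl.
  move=> /le_lt_trans/(_ rd); rewrite ltr_norml => /andP[+ _].
  by rewrite /GRing.scale/=; lra.
have pE : p = p + 0 *: v by rewrite scale0r addr0.
have dh r : `|r| < d ->
    is_derive r (1 : R) (fun s => u (p + s *: v)) ('D_v u (p + r *: v)).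
  move=> /inH/Cu[_ /(_ v v)[dv _ _ _]]; exact: derivable_line.
have d2 : is_derive (0 : R) (1 : R) (fun s => 'D_v u (p + s *: v)) ('D_v ('D_v u) p).
  rewrite [X in 'D_v _ X]pE; apply: derivable_line.
  by rewrite -pE; have [_ /(_ v v)[]] := Cu _ p0.
rewrite [X in 'D_v u X]pE; split.
  exact: (@lower_jet_taylor _ _ (fun s => 'D_v u (p + s *: v)) _ d d0).
apply: (@lower_jet_taylor _ _ (fun s => - 'D_v u (p + s *: v)) _ d d0) => r rd.
by have ? := dh r rd; apply: is_deriveN.
Qed.

Lemma weighted_divE (R : realType) (n : nat) (a : R) (u : 'rV[R]_n * R -> R)
    (p : 'rV[R]_n * R) : C2_on (@half_space R n) u -> half_space p ->
  weighted_div a u p = p.2 `^ a *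
    (\sum_i 'D_(dir_x R i) ('D_(dir_x R i) u) p +
     'D_(dir_l R n) ('D_(dir_l R n) u) p + a / p.2 * 'D_(dir_l R n) u p).
Proof.
move=> Cu Hp; have p0 : 0 < p.2 by [].
have dM v d : is_derive p v (fun q => q.2 `^ a) d ->
    'D_v (fun q => q.2 `^ a * 'D_v u q) p = p.2 `^ a * 'D_v ('D_v u) p + 'D_v u p * d.
  move=> [dp <-]; have [_ /(_ v v)[_ _ d2 _]] := Cu _ Hp.
  by rewrite (@deriveM _ _ (fun q => q.2 `^ a) ('D_v u)).
have dx i : is_derive p (dir_x R i) (fun q : 'rV[R]_n * R => q.2 `^ a) 0.
  apply: is_derive_line => /=.
  under eq_fun do rewrite scaler0 addr0.
  exact: is_derive_cst.
have dl : is_derive p (dir_l R n) (fun q : 'rV[R]_n * R => q.2 `^ a)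
    (a * p.2 `^ (a - 1)).
  apply: is_derive_line => /=.
  have H1 := is_derive1_powR a p0.
  have H2 : is_derive (0 : R) (1 : R) (fun r : R => p.2 + r *: (1 : R)) (1 : R).
    by apply: is_derive_eq; rewrite /GRing.scale/=; lra.
  have p00 : p.2 = p.2 + 0 *: (1 : R) by rewrite scale0r addr0.
  rewrite {1}p00 in H1.
  have := @is_derive1_comp _ (fun t => t `^ a) _ (0 : R) _ _ H1 H2.
  by rewrite mulr1.
rewrite /weighted_div mulrDr mulrDr -addrA; congr (_ + _).
  rewrite mulr_sumr; apply: eq_bigr => i _.
  by rewrite (dM _ _ (dx i)) mulr0 addr0.
rewrite (dM _ _ dl).
congr (_ + _).
have -> : p.2 `^ a = p.2 `^ (a - 1) * p.2.
  rewrite -[X in _ * X]powRr1 ?ltW// -powRD ?subrK//.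
  by rewrite (gt_eqF p0) implybT.
by field; rewrite gt_eqF.
Qed.

Lemma bounded_extension_subsol (R : realType) (n : nat) (a : R)
    (u : 'rV[R]_n * R -> R) (p : 'rV[R]_n * R) :
  bounded_extension a u -> 0 < p.2 ->
  subsol a u p /\ subsol a (fun q => - u q) p.
Proof.
move=> [_ _ Cu Eu] p0; have := Eu p p0; rewrite weighted_divE// => /eqP.
rewrite mulf_eq0 gt_eqF ?powR_gt0//= => /eqP E.
have lx i r : (p.1 + r *: delta_mx 0 i, p.2) = p + r *: dir_x R i.
  by case: p {p0 E} => x l; rewrite /dir_x; congr (_, _); rewrite /= scaler0 addr0.
have ll r : (p.1, p.2 + r) = p + r *: dir_l R n.
  case: p {p0 E lx} => x l; rewrite /dir_l; congr (_, _); rewrite /= ?scaler0 ?addr0//.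
  by rewrite [r *: 1]mulr1.
split.
  exists (fun i => 'D_(dir_x R i) u p), (fun i => 'D_(dir_x R i) ('D_(dir_x R i) u) p).
  exists ('D_(dir_l R n) u p), ('D_(dir_l R n) ('D_(dir_l R n) u) p).
  split=> [i||]; last by rewrite E.
    under eq_fun do rewrite lx.
    by case: (C2_lower_jet (dir_x R i) Cu p0).
  under eq_fun do rewrite ll.
  by case: (C2_lower_jet (dir_l R n) Cu p0).
exists (fun i => - 'D_(dir_x R i) u p), (fun i => - 'D_(dir_x R i) ('D_(dir_x R i) u) p).
exists (- 'D_(dir_l R n) u p), (- 'D_(dir_l R n) ('D_(dir_l R n) u) p).
split=> [i||]; last by rewrite sumrN mulrN -!opprD E oppr0.
  under eq_fun do rewrite lx.
  by case: (C2_lower_jet (dir_x R i) Cu p0).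
under eq_fun do rewrite ll.
by case: (C2_lower_jet (dir_l R n) Cu p0).
Qed.

Definition trace_jet (R : realType) (g : R) (h : R -> R) (c : R) : Prop :=
  forall e : R, 0 < e -> exists2 d : R, 0 < d &
    forall l : R, 0 < l < d -> `|h l - h 0 - c * l `^ (2 * g)| <= e * l `^ (2 * g).

(** The derivative of h - k/(2g) l^(2g) is l^(2g-1) times the flux minus k. The choices k = F - 2ge
    and k = F + 2ge fix its sign near 0, and the mean value theorem on [0, l] asks only for
    continuity at the endpoint 0. *)
Lemma trace_jet_flux (R : realType) (g F : R) (h h1 : R -> R) : 0 < g ->
  {within [set l : R | 0 <= l], continuous h} ->
  (forall l : R, 0 < l -> is_derive l (1 : R) h (h1 l)) ->
  l `^ (1 - 2 * g) * h1 l @[l --> 0^'+] --> F ->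
  trace_jet g h (F / (2 * g)).
Proof.
move=> g0 ch dh /cvgrPdist_le HF e e0.
have e1 : 0 < 2 * g * e by rewrite !mulr_gt0.
have := HF _ e1; rewrite near_withinE => /nbhs_ballP[d /= d0 H].
exists d => // l /andP[l0 ld].
pose phi (k t : R) := h t - k / (2 * g) * `|t| `^ (2 * g).
have dphi (k x : R) : 0 < x ->
    is_derive x (1 : R) (phi k) (x `^ (2 * g - 1) * (x `^ (1 - 2 * g) * h1 x - k)).
  move=> x0; have ? := dh x x0; have ? := is_derive1_powR (2 * g) x0.
  have D : is_derive x (1 : R) (fun t => h t - k / (2 * g) * t `^ (2 * g))
      (x `^ (2 * g - 1) * (x `^ (1 - 2 * g) * h1 x - k)).
    have xx : x `^ (2 * g - 1) * x `^ (1 - 2 * g) = 1.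
      rewrite -powRD ?(gt_eqF x0) ?implybT//.
      have -> : 2 * g - 1 + (1 - 2 * g) = 0 by ring.
      by rewrite powRr0.
    have E : x `^ (2 * g - 1) * (x `^ (1 - 2 * g) * h1 x - k) =
        h1 x - x `^ (2 * g - 1) * k by rewrite mulrBr mulrA xx mul1r.
    by rewrite E; apply: is_derive_eq; rewrite /GRing.scale/=; field; lra.
  apply: near_eq_is_derive D.
  near=> t; rewrite /phi ger0_norm//; apply: ltW; near: t.
  exact: lt_nbhsr.
have cphi k : {within `[0, l], continuous (phi k)}.
  rewrite /phi => x; apply: (@continuousB R R (subspace `[0, l]) h
    (fun t => k / (2 * g) * `|t| `^ (2 * g))).
    apply: continuous_subspaceW ch _ => y /=.
    by rewrite in_itv/= => /andP[].
  apply: continuous_subspaceT => y.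
  apply: cvgMr; apply: norm_powR_continuous; lra.
have dF (x : R) : 0 < x < l -> `|F - x `^ (1 - 2 * g) * h1 x| <= 2 * g * e.
  move=> /andP[x0 xl]; apply: H => //=.
  by rewrite /ball/= sub0r normrN gtr0_norm// (lt_trans xl).
have p2 : 0 < 2 * g by lra.
have mvt (k : R) : exists2 x : R, 0 < x < l & phi k l - phi k 0 =
    x `^ (2 * g - 1) * (x `^ (1 - 2 * g) * h1 x - k) * l.
  have [|x] := @MVT _ (phi k)
      (fun x => x `^ (2 * g - 1) * (x `^ (1 - 2 * g) * h1 x - k)) 0 l l0 _ (cphi k).
    by move=> x; rewrite in_itv/= => /andP[x0 _]; exact: dphi.
  by rewrite in_itv/= subr0 => x01 E; exists x.
have phi0 k : phi k 0 = h 0.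
  by rewrite /phi normr0 powR0 ?mulr0 ?subr0 ?gt_eqF.
have phil k : phi k l = h l - k / (2 * g) * l `^ (2 * g).
  by rewrite /phi gtr0_norm.
rewrite ler_norml; apply/andP; split.
  have [x x01] := mvt (F - 2 * g * e); rewrite phi0 phil => E.
  have : 0 <= x `^ (2 * g - 1) * (x `^ (1 - 2 * g) * h1 x - (F - 2 * g * e)) * l.
    rewrite !mulr_ge0 ?powR_ge0 ?(ltW l0)//.
    by have := dF x x01; rewrite ler_norml => /andP[]; lra.
  rewrite -E; have -> : (F - 2 * g * e) / (2 * g) = F / (2 * g) - e by field; lra.
  lra.
have [x x01] := mvt (F + 2 * g * e); rewrite phi0 phil => E.
have : x `^ (2 * g - 1) * (x `^ (1 - 2 * g) * h1 x - (F + 2 * g * e)) * l <= 0.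
  rewrite mulr_le0_ge0 ?(ltW l0)// mulr_ge0_le0 ?powR_ge0//.
  by have := dF x x01; rewrite ler_norml => /andP[]; lra.
rewrite -E; have -> : (F + 2 * g * e) / (2 * g) = F / (2 * g) + e by field; lra.
lra.
Unshelve. all: by end_near. Qed.

Lemma bounded_solution_trace_jet (R : realType) (n : nat) (g d : R) (f : R -> R)
    (u : 'rV[R]_n * R -> R) (x : 'rV[R]_n) : 0 < g -> 0 < d ->
  bounded_solution g d f u ->
  trace_jet g (fun l => u (x, l)) (- f (u (x, 0)) / (2 * g * d)).
Proof.
move=> g0 d0 [[_ cu Cu _] /(_ x)[cF Ef]].
have -> : - f (u (x, 0)) / (2 * g * d) = - conormal (1 - 2 * g) u x / (2 * g).
  by rewrite -Ef; field; rewrite !gt_eqF.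
rewrite /conormal opprK.
apply: (@trace_jet_flux _ _ _ _ (fun l => 'D_(dir_l R n) u (x, l))) => //.
  apply: continuous_within_comp cu _ _ => //.
  by apply: continuous_fct_pair => l; [exact: cvg_cst|exact: cvg_id].
move=> l l0.
have lE s : (x, s) = (x, 0) + s *: dir_l R n.
  by rewrite /dir_l; congr (_, _); rewrite /= ?scaler0 ?addr0// add0r [s *: 1]mulr1.
under eq_fun do rewrite lE.
rewrite (lE l); apply: derivable_line; rewrite -lE.
by have [_ /(_ (dir_l R n) (dir_l R n))[]] := Cu (x, l) l0.
Qed.

(** * Consequences of the concavity of the nonlinearity *)

Lemma mvt_lt (R : realType) (f : R -> R) (a b x y : R) :
  {within `[a, b], continuous f} ->
  (forall z, a < z < b -> derivable f z 1) -> a <= x -> x < y -> y <= b ->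
  exists2 z, x < z < y & f y - f x = derive1 f z * (y - x).
Proof.
move=> cf df ax xy yb.
have cxy : {within `[x, y], continuous f}.
  apply: continuous_subspaceW cf => z /=.
  by rewrite !in_itv/= => /andP[? ?]; apply/andP; split; lra.
have [|z] := MVT xy (df := derive1 f) _ cxy.
  move=> z; rewrite in_itv/= => /andP[xz zy]; rewrite derive1E.
  by apply: derivableP; apply: df; rewrite (le_lt_trans ax)//= (lt_le_trans zy).
by rewrite in_itv/= => H E; exists z.
Qed.

Section concave_nonlinearity.
Variables (R : realType) (f : R -> R).
Hypothesis cf : {within `[-1, 1], continuous f}.
Hypothesis df : forall x : R, -1 < x < 1 ->
  derivable f x 1 /\ derivable (derive1 f) x 1.
Hypothesis f_at0 : f 0 = 0.
Hypothesis f_at1 : f 1 = 0.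
Hypothesis f_concave : forall x : R, 0 < x < 1 -> derive1n 2 f x < 0.

Let mvtf (x y : R) : -1 <= x -> x < y -> y <= 1 ->
  exists2 z, x < z < y & f y - f x = derive1 f z * (y - x).
Proof. by apply: mvt_lt => // z /df[]. Qed.

Lemma derive1_concave_lt (x y : R) : 0 < x -> x < y -> y < 1 ->
  derive1 f y < derive1 f x.
Proof.
move=> x0 xy y1.
have ddf z : x <= z <= y -> derivable (derive1 f) z 1.
  by move=> /andP[xz zy]; have [|//] := df (x := z); apply/andP; split; lra.
have cdf : {within `[x, y], continuous (derive1 f)}.
  by apply: derivable_within_continuous => z; rewrite in_itv/=; exact: ddf.
have ddf' z : x < z < y -> derivable (derive1 f) z 1.
  by move=> /andP[xz zy]; apply: ddf; rewrite !ltW.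
have [z /andP[xz zy] E] := mvt_lt cdf ddf' (lexx x) xy (lexx y).
rewrite -subr_lt0 E pmulr_llt0 ?subr_gt0//.
by apply: f_concave; apply/andP; split; lra.
Qed.

(** f(y)/y and the slope of f between y and k y are values of f' at points z1 < y < z2, so the
    second is smaller: f(y)/y strictly decreases. *)
Lemma concave_mul_lt (k y : R) : 1 < k -> 0 < y -> k * y <= 1 -> f (k * y) < k * f y.
Proof.
move=> k1 y0 ky1; have yky : y < k * y by rewrite ltr_pMl.
have [z1 /andP[z10 z1y] E1] : exists2 z, 0 < z < y & f y - f 0 = derive1 f z * (y - 0).
  by apply: mvtf; lra.
have [z2 /andP[z2y z2k] E2] : exists2 z, y < z < k * y &
    f (k * y) - f y = derive1 f z * (k * y - y) by apply: mvtf; lra.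
have := derive1_concave_lt z10 (lt_trans z1y z2y) (lt_le_trans z2k ky1).
rewrite f_at0 !subr0 in E1.
have ky0 : 0 < (k - 1) * y by rewrite mulr_gt0//; lra.
have E3 : (k - 1) * f y = derive1 f z1 * ((k - 1) * y) by rewrite E1; ring.
by rewrite -(ltr_pM2r ky0) -E3; lra.
Qed.

(** c is a zero of f' given by Rolle's theorem on [0, 1]; beyond it f' is negative. *)
Lemma concave_decreasing_near1 : exists2 c : R, 0 < c < 1 &
  forall x y : R, c <= x -> x < y -> y <= 1 -> f y < f x.
Proof.
have [z1 /andP[z10 z11] E1] : exists2 z : R, 0 < z < 1 & f 1 - f 0 = derive1 f z * (1 - 0).
  by apply: mvtf; lra.
rewrite f_at0 f_at1 !subr0 mulr1 in E1.
exists z1; first by rewrite z10.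
move=> x y zx xy y1.
have [z /andP[xz zy] E] : exists2 z, x < z < y & f y - f x = derive1 f z * (y - x).
  by apply: mvtf; lra.
rewrite -subr_lt0 E pmulr_llt0 ?subr_gt0// E1.
by apply: derive1_concave_lt; lra.
Qed.

Lemma derivative_bound_lipschitz (K x y : R) :
  (forall x : R, -1 < x < 1 -> `|derive1 f x| <= K) ->
  -1 <= x -> x <= y -> y <= 1 -> `|f y - f x| <= K * (y - x).
Proof.
move=> fK x1; rewrite le_eqVlt => /predU1P[->|xy] y1.
  by rewrite !subrr normr0 mulr0.
have [z /andP[xz zy] ->] := mvtf x1 xy y1.
have yx0 : 0 <= y - x by rewrite subr_ge0 ltW.
rewrite normrM (ger0_norm yx0) ler_wpM2r// fK//; apply/andP; split; lra.
Qed.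

End concave_nonlinearity.

(** * Functions of two variables *)

Definition planar_subsol (R : realType) (a : R) (v : R * R -> R) (x l : R) : Prop :=
  exists b c bl cl : R, [/\ lower_jet (fun r => v (x + r, l)) b c,
    lower_jet (fun r => v (x, l + r)) bl cl & 0 <= c + cl + a / l * bl].

Lemma subsol_on_line (R : realType) (a : R) (v : R * R -> R) (p : 'rV[R]_1 * R) :
  subsol a (on_line v) p <-> planar_subsol a v (p.1 0 0) p.2.
Proof.
have E : (fun r => v (p.1 0 0 + r, p.2)) =
    (fun r => on_line v (p.1 + r *: delta_mx 0 0, p.2)).
  by apply/funext => r; rewrite /on_line/= !mxE/= mulr1.
split=> [[b [c [bl [cl [Hx Hl S]]]]]|[b [c [bl [cl [Hx Hl S]]]]]].
  exists (b 0), (c 0), bl, cl; split => //; last by rewrite big_ord1 in S.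
  by rewrite E; exact: Hx.
exists (fun=> b), (fun=> c), bl, cl; split => // [i|]; last by rewrite big_ord1.
by rewrite (ord1 i) -E.
Qed.

Lemma planar_subsolD (R : realType) (a : R) (v w : R * R -> R) (x l : R) :
  planar_subsol a v x l -> planar_subsol a w x l ->
  planar_subsol a (fun q => v q + w q) x l.
Proof.
move=> [b [c [bl [cl [vx vl vS]]]]] [b' [c' [bl' [cl' [wx wl wS]]]]].
exists (b + b'), (c + c'), (bl + bl'), (cl + cl').
by split; [exact: lower_jetD|exact: lower_jetD|rewrite mulrDr; lra].
Qed.

Lemma planar_subsolZ (R : realType) (a k : R) (v : R * R -> R) (x l : R) :
  0 < k -> planar_subsol a v x l -> planar_subsol a (fun q => k * v q) x l.
Proof.
move=> k0 [b [c [bl [cl [vx vl vS]]]]].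
exists (k * b), (k * c), (k * bl), (k * cl).
split; [exact: lower_jetZ|exact: lower_jetZ|].
by have := mulr_ge0 (ltW k0) vS; rewrite mulrDr mulrDr mulrCA.
Qed.

Lemma planar_subsol_shift (R : realType) (a : R) (v : R * R -> R) (x l t : R) :
  planar_subsol a v (x + t) l -> planar_subsol a (fun q => v (q.1 + t, q.2)) x l.
Proof.
move=> [b [c [bl [cl [vx vl vS]]]]]; exists b, c, bl, cl; split => //=.
by under eq_fun do rewrite addrAC.
Qed.

Lemma planar_subsol_reflect (R : realType) (a : R) (v : R * R -> R) (x l : R) :
  planar_subsol a v (- x) l -> planar_subsol a (fun q => v (- q.1, q.2)) x l.
Proof.
move=> [b [c [bl [cl [vx vl vS]]]]]; exists (- b), c, bl, cl; split => //=.
have := lower_jet_comp (-1) 0 vx; rewrite mulr0 addr0 sqrrN expr1n mulr1 mulrN1.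
congr lower_jet; apply/funext => r; congr (v (_, _)); ring.
Qed.

Lemma const_mx_continuous (R : realType) : continuous (fun x : R => const_mx x : 'rV[R]_1).
Proof.
move=> x; apply/cvg_ballP => e e0; have : \forall y \near x, ball x e y by exact: nbhsx_ballx.
by apply: filterS => y xy; split => // i j; rewrite !mxE.
Qed.

Lemma continuous_on_line (R : realType) (n : nat) (v : R * R -> R)
    (phi : 'rV[R]_n * R -> R) :
  {within @closed_half_space R 1, continuous (on_line v)} -> continuous phi ->
  {within @closed_half_space R n, continuous (fun p => v (phi p, p.2))}.
Proof.
move=> cv cphi.
have -> : (fun p => v (phi p, p.2)) =
    (fun p => on_line v (const_mx (phi p) : 'rV_1, p.2)).
  by apply/funext => p; rewrite /on_line/= mxE.
apply: (continuous_within_comp cv) => //.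
apply: continuous_fct_pair; last exact: snd_continuous.
move=> p; apply: (@continuous_comp _ _ _ phi (fun x : R => const_mx x : 'rV_1)).
  exact: cphi.
exact: const_mx_continuous.
Qed.

Lemma closed_closed_half_space (R : realType) (n : nat) : closed (@closed_half_space R n).
Proof.
have -> : @closed_half_space R n = snd @^-1` [set x : R | 0 <= x] by [].
by apply: closed_comp => [p _|]; [exact: snd_continuous|exact: closed_ge].
Qed.

Lemma nbhs_closed_half_space (R : realType) (n : nat) (p : 'rV[R]_n * R) :
  0 < p.2 -> nbhs p (@closed_half_space R n).
Proof.
move=> p0.
have := @cvgr_gt R _ (nbhs p) (nbhs_filter p) snd p.2 (@snd_continuous R n p) 0 p0.
by apply: filterS => q /ltW.
Qed.

Lemma half_space_max (R : realType) (n : nat) (g M : R) (w : 'rV[R]_n * R -> R) :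
  0 < g < 1 -> {within @closed_half_space R n, continuous w} ->
  (forall p, 0 <= p.2 -> w p <= M) -> (forall x, w (x, 0) <= 0) ->
  (forall p, 0 < p.2 -> subsol (1 - 2 * g) w p) ->
  forall p, 0 <= p.2 -> w p <= 0.
Proof.
move=> g01 cw wM w0 sw p p0.
apply: (phragmen_lindelof g01 (@closed_closed_half_space R n) _ cw wM) => //.
move=> [x l]; rewrite /closed_half_space/= le_eqVlt => /predU1P[<-|l0]; first by left.
by right; split => //; [exact: nbhs_closed_half_space|exact: sw].
Qed.

Lemma half_plane_max (R : realType) (g M : R) (w : R * R -> R) :
  0 < g < 1 -> {within @closed_half_space R 1, continuous (on_line w)} ->
  (forall x l : R, 0 <= l -> w (x, l) <= M) -> (forall x, w (x, 0) <= 0) ->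
  (forall x l : R, 0 < l -> planar_subsol (1 - 2 * g) w x l) ->
  forall x l : R, 0 <= l -> w (x, l) <= 0.
Proof.
move=> g01 cw wM w0 sw x l l0.
have := @half_space_max R 1 g M (on_line w) g01 cw.
move=> /(_ _ _ _ (const_mx x, l)); rewrite /on_line/= mxE; apply => //.
  by move=> p p0; exact: wM.
by move=> p p0; apply/subsol_on_line; exact: sw.
Qed.

(** With rho = |(x - x1, l)| the function is l^(2g) rho^(-4). The operator l^(-a) div(l^a grad .)
    maps l^(2g) rho^(-k) to k (k - 1 - 2g) l^(2g) rho^(-k-2). The a-harmonic exponent k = 1 + 2g is
    that of the Kelvin transform of l^(2g); the faster decay k = 4 gives the positive factor 12 - 8g
    and involves only integer powers of [Q] = rho^2. *)
Lemma planar_barrier (R : realType) (g x1 x l : R) : 0 < g < 1 -> 0 < l ->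
  planar_subsol (1 - 2 * g)
    (fun q => `|q.2| `^ (2 * g) * ((q.1 - x1) ^+ 2 + q.2 ^+ 2) ^- 2) x l.
Proof.
move=> /andP[g0 g1] l0; pose y := x - x1; pose P := l `^ (2 * g - 2).
pose Q := y ^+ 2 + l ^+ 2.
have l2 : 0 < l ^+ 2 by rewrite exprn_gt0.
have Q0 : 0 < Q by rewrite ltr_wpDl ?sqr_ge0.
have P0 : 0 < P by rewrite powR_gt0.
have lnz : l != 0 by rewrite gt_eqF.
have P1 : l `^ (2 * g - 1) = l * P.
  rewrite /P -{2}[l]powRr1 ?ltW// -powRD ?lnz ?implybT//.
  by congr powR; ring.
have P2 : l `^ (2 * g) = l ^+ 2 * P.
  rewrite /P -(powR_mulrn _ (ltW l0)) -powRD ?lnz ?implybT//.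
  by congr powR; ring.
pose qx r := (y + r) ^+ 2 + l ^+ 2.
have qx0 r : qx r != 0 by rewrite gt_eqF// /qx ltr_wpDl ?sqr_ge0.
have dqx r : is_derive r (1 : R) qx (2 * (y + r)).
  by rewrite /qx; apply: is_derive_eq; rewrite /GRing.scale/=; ring.
pose ql r := y ^+ 2 + (l + r) ^+ 2.
have ql0 r : `|r| < l -> ql r != 0.
  rewrite ltr_norml => /andP[rl _]; rewrite gt_eqF// /ql ltr_wpDl ?sqr_ge0//.
  by rewrite exprn_gt0//; lra.
have dql r : is_derive r (1 : R) ql (2 * (l + r)).
  by rewrite /ql; apply: is_derive_eq; rewrite /GRing.scale/=; ring.
have dpow (z r : R) : `|r| < l ->
    is_derive r (1 : R) (fun r => (l + r) `^ z) (z * (l + r) `^ (z - 1)).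
  by rewrite ltr_norml => /andP[rl _]; apply: is_derive_powR_shift; lra.
have n0 : `|0 : R| < l by rewrite normr0.
pose hx r := (l ^+ 2 * P) * (- 4 * (y + r) * qx r ^- 3).
pose hl r := 2 * g * (l + r) `^ (2 * g - 1) * ql r ^- 2 +
             (l + r) `^ (2 * g) * (- 4 * (l + r) * ql r ^- 3).
exists (hx 0), ((l ^+ 2 * P) * (- 4 * Q ^- 3 + 24 * y ^+ 2 * Q ^- 4)).
exists (hl 0), (2 * g * (2 * g - 1) * P * Q ^- 2 +
   2 * (2 * g * (l * P)) * (- 4 * l * Q ^- 3) +
   (l ^+ 2 * P) * (- 4 * Q ^- 3 + 24 * l ^+ 2 * Q ^- 4)).
split.
- have -> : (fun r => `|l| `^ (2 * g) * ((x + r - x1) ^+ 2 + l ^+ 2) ^- 2) =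
      (fun r => (l ^+ 2 * P) * (qx r ^+ 2)^-1).
    apply/funext => r; rewrite gtr0_norm// P2 /qx /y; congr (_ * (_ ^+ 2 + _) ^- 2).
    by ring.
  apply: (@lower_jet_taylor _ _ hx _ l l0) => [r rl|] /=.
    have ? := dqx r; have qn := qx0 r.
    have q2 : qx r ^+ 2 != 0 by rewrite expf_neq0.
    have ? : is_derive r (1 : R) (fun r => qx r ^+ 2) (2 * qx r * (2 * (y + r))).
      by apply: is_derive_eq; rewrite /GRing.scale/=; ring.
    have ? := is_deriveV q2 _.
    by apply: is_derive_eq; rewrite /GRing.scale/= /hx; field.
  have ? := dqx 0; have qn := qx0 0.
  have q3 : qx 0 ^+ 3 != 0 by rewrite expf_neq0.
  have ? : is_derive (0 : R) (1 : R) (fun r => qx r ^+ 3) (3 * qx 0 ^+ 2 * (2 * y)).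
    by apply: is_derive_eq; rewrite /GRing.scale/= addr0; ring.
  have ? := is_deriveV q3 _.
  have QE : Q = qx 0 by rewrite /qx addr0.
  by rewrite QE; apply: is_derive_eq; rewrite /GRing.scale/= addr0; field.
- apply: (@lower_jet_le _ _ (fun r => (l + r) `^ (2 * g) * (ql r ^+ 2)^-1) _ _ _ l0).
  + by rewrite /ql /y !addr0 gtr0_norm.
  + move=> r rl /=; rewrite ger0_norm//.
    by move: rl; rewrite ltr_norml => /andP[]; lra.
  apply: (@lower_jet_taylor _ _ hl _ l l0) => [r rl|] /=.
    have ? := dql r; have qn := ql0 r rl; have ? := dpow (2 * g) r rl.
    have q2 : ql r ^+ 2 != 0 by rewrite expf_neq0.
    have ? : is_derive r (1 : R) (fun r => ql r ^+ 2) (2 * ql r * (2 * (l + r))).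
      by apply: is_derive_eq; rewrite /GRing.scale/=; ring.
    have ? := is_deriveV q2 _.
    by apply: is_derive_eq; rewrite /GRing.scale/= /hl; field.
  have ? := dql 0; have qn := ql0 0 n0.
  have d1 := dpow (2 * g) 0 n0; have d2 := dpow (2 * g - 1) 0 n0.
  rewrite addr0 P1 in d1.
  have e2 : 2 * g - 1 - 1 = 2 * g - 2 by ring.
  rewrite addr0 e2 -/P in d2.
  have q2 : ql 0 ^+ 2 != 0 by rewrite expf_neq0.
  have q3 : ql 0 ^+ 3 != 0 by rewrite expf_neq0.
  have ? : is_derive (0 : R) (1 : R) (fun r => ql r ^+ 2) (2 * ql 0 * (2 * l)).
    by apply: is_derive_eq; rewrite /GRing.scale/= addr0; ring.
  have ? : is_derive (0 : R) (1 : R) (fun r => ql r ^+ 3) (3 * ql 0 ^+ 2 * (2 * l)).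
    by apply: is_derive_eq; rewrite /GRing.scale/= addr0; ring.
  have ? := is_deriveV q2 _.
  have ? := is_deriveV q3 _.
  have QE : Q = ql 0 by rewrite /ql addr0.
  by rewrite QE; apply: is_derive_eq; rewrite /GRing.scale/= !addr0 P1 P2; field.
- rewrite /hx /hl /ql !addr0 -/Q P1 P2.
  have -> : l ^+ 2 * P * (-4 * Q ^- 3 + 24 * y ^+ 2 * Q ^- 4) +
    (2 * g * (2 * g - 1) * P * Q ^- 2 +
     2 * (2 * g * (l * P)) * (-4 * l * Q ^- 3) +
     l ^+ 2 * P * (-4 * Q ^- 3 + 24 * l ^+ 2 * Q ^- 4)) +
    (1 - 2 * g) / l * (2 * g * (l * P) * Q ^- 2 +
     l ^+ 2 * P * (-4 * l * Q ^- 3)) = l ^+ 2 * P * Q ^- 3 * (12 - 8 * g).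
    have -> : y ^+ 2 = Q - l ^+ 2 by rewrite /Q; ring.
    by field; rewrite lnz gt_eqF.
  rewrite !mulr_ge0 ?invr_ge0 ?exprn_ge0 ?(ltW P0) ?(ltW Q0) ?(ltW l0)//; lra.
Qed.

Lemma on_line_trace_near (R : realType) (w : R * R -> R) (x e : R) :
  {within @closed_half_space R 1, continuous (on_line w)} -> 0 < e ->
  exists2 d : R, 0 < d & forall y l : R, `|y - x| < d -> 0 <= l < d ->
    `|w (x, 0) - w (y, l)| < e.
Proof.
move=> /subspace_continuousP/(_ (const_mx x, 0)).
rewrite /closed_half_space/= lexx => /(_ isT) /cvgrPdist_lt H e0.
have := H _ e0; rewrite near_withinE => /nbhs_ballP[d /= d0 Hd].
exists d => // y l yx /andP[l0 ld].
have mE (z : R) : (const_mx z : 'rV[R]_1) 0 0 = z by rewrite mxE.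
have : `|on_line w (const_mx x, 0) - on_line w (const_mx y, l)| < e.
  apply: Hd => //; split => /=; last by rewrite /ball/= sub0r normrN ger0_norm.
  by split => // i j; rewrite !mxE /ball/= distrC.
by rewrite /on_line/= !mE.
Qed.

(** Near (x1, 0), w lies below a negative constant. Off a small box around this point a multiple of
    the planar barrier, which vanishes like l^(2g) on l = 0, can be added to w while keeping it
    nonpositive; above x0 this bounds w by a negative multiple of l^(2g), that is, it gives the flux
    a strict sign. *)
Lemma hopf (R : realType) (g : R) (w : R * R -> R) (x0 x1 : R) : 0 < g < 1 ->
  {within @closed_half_space R 1, continuous (on_line w)} ->
  (forall x l : R, 0 <= l -> w (x, l) <= 0) ->
  (forall x l : R, 0 < l -> planar_subsol (1 - 2 * g) w x l) ->
  w (x1, 0) < 0 -> x0 != x1 ->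
  exists2 c : R, 0 < c & forall l : R, 0 < l < 1 -> w (x0, l) <= - c * l `^ (2 * g).
Proof.
move=> g01 cw w0 sw w1 x01; have /andP[g0 g1] := g01.
pose dl : R := - w (x1, 0) / 2.
have dl0 : 0 < dl by rewrite /dl; lra.
have [d d0 Hd] := on_line_trace_near x1 cw dl0.
have x010 : 0 < `|x0 - x1| by rewrite normr_gt0 subr_eq0.
pose r : R := Num.min d `|x0 - x1| / 2.
have m0 : 0 < Num.min d `|x0 - x1| by rewrite lt_min d0.
have r0 : 0 < r by rewrite divr_gt0.
have rm : r < Num.min d `|x0 - x1| by rewrite /r; lra.
have [rd rx] : r < d /\ r < `|x0 - x1| by move: rm; rewrite lt_min => /andP.
have wr (x l : R) : `|x - x1| <= r -> 0 <= l <= r -> w (x, l) <= - dl.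
  move=> xr /andP[l0 lr].
  have := Hd x l (le_lt_trans xr rd); rewrite l0 (le_lt_trans lr rd) => /(_ isT).
  by rewrite ltr_norml /dl; lra.
have r2 : 0 < r ^+ 2 by rewrite exprn_gt0.
have rg : 0 < r `^ (2 * g) by rewrite powR_gt0.
(* On the boundary of the box rho >= r and l <= r, so the barrier is at most r^(2g) / r^4 and [eta]
   times it at most [dl]. *)
pose eta : R := dl * r ^+ 4 / r `^ (2 * g).
have eta0 : 0 < eta by rewrite divr_gt0// mulr_gt0// exprn_gt0.
pose B (q : R * R) := `|q.2| `^ (2 * g) * ((q.1 - x1) ^+ 2 + q.2 ^+ 2) ^- 2.
pose W q := w q + eta * B q.
(* The closed half-plane deprived of the box of size r around (x1, 0); r < |x0 - x1| keeps the whole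
   vertical half-line above x0 inside. *)
pose D : set ('rV[R]_1 * R) :=
  @closed_half_space R 1 `&` ([set p : 'rV[R]_1 * R | r <= `|p.1 0 0 - x1|] `|`
                                [set p : 'rV[R]_1 * R | r <= p.2]).
have cn : continuous (fun p : 'rV[R]_1 * R => `|p.1 0 0 - x1|).
  move=> p; apply: (@continuous_comp _ R R (fun q : 'rV[R]_1 * R => q.1 0 0 - x1)).
    apply: continuousB; last exact: cst_continuous.
    exact: coord_fst_continuous.
  exact: norm_continuous.
have cD : closed D.
  apply: closedI; first exact: closed_closed_half_space.
  apply: closedU.
    by apply: (@closed_comp _ _ (fun p : 'rV[R]_1 * R => `|p.1 0 0 - x1|)
        [set t | r <= t]) => [p _|];
      [exact: cn|exact: closed_ge].
  by apply: (@closed_comp _ _ (fun p : 'rV[R]_1 * R => p.2) [set t | r <= t]) => [p _|];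
    [exact: snd_continuous|exact: closed_ge].
have Qr (x l : R) : 0 <= l -> r <= `|x - x1| \/ r <= l -> r ^+ 2 <= (x - x1) ^+ 2 + l ^+ 2.
  move=> l0 [rx1|rl].
    rewrite -(real_normK (num_real (x - x1))) ler_wpDr ?sqr_ge0//.
    by rewrite ler_pXn2r ?nnegrE// ltW.
  by rewrite ler_wpDl ?sqr_ge0// ler_pXn2r ?nnegrE// ltW.
have DQ p : D p -> r ^+ 2 <= (p.1 0 0 - x1) ^+ 2 + p.2 ^+ 2.
  by move=> [p0 H]; exact: Qr.
have r4 : 0 < r ^+ 4 by rewrite exprn_gt0.
have Br (x l : R) : 0 <= l -> r ^+ 2 <= (x - x1) ^+ 2 + l ^+ 2 ->
    B (x, l) <= l `^ (2 * g) / r ^+ 4.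
  move=> l0 Q; rewrite /B/= ger0_norm// ler_wpM2l ?powR_ge0//.
  have Q0 := lt_le_trans r2 Q.
  rewrite lef_pV2 ?posrE ?exprn_gt0// (_ : r ^+ 4 = (r ^+ 2) ^+ 2); last by ring.
  by rewrite ler_pXn2r ?nnegrE// ltW.
have cB p : D p -> {for p, continuous (on_line B)}.
  move=> Dp; have Q0 := lt_le_trans r2 (DQ _ Dp).
  rewrite /on_line /B /=.
  apply: (@continuousM _ _ (fun q : 'rV[R]_1 * R => `|q.2| `^ (2 * g))
    (fun q => ((q.1 0 0 - x1) ^+ 2 + q.2 ^+ 2) ^- 2)).
    apply: (@continuous_comp _ R R snd (fun y : R => `|y| `^ (2 * g))).
      exact: cvg_snd.
    by apply: norm_powR_continuous; lra.
  apply: (@continuousV _ _ (fun q : 'rV[R]_1 * R => ((q.1 0 0 - x1) ^+ 2 + q.2 ^+ 2) ^+ 2)).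
    by rewrite expf_neq0// gt_eqF.
  apply: continuous_fctX; apply: continuous_fctD.
    apply: continuous_fctX; apply: continuous_fctD; last exact: cst_continuous.
    exact: coord_fst_continuous.
  by apply: continuous_fctX; exact: snd_continuous.
have cW : {within D, continuous (on_line W)}.
  have : {within D, continuous (on_line w)} by apply: continuous_subspaceW cw => p [].
  move=> /subspace_continuousP cwD; apply/subspace_continuousP => p Dp.
  rewrite /on_line /W.
  apply: cvgD; first exact: cwD.
  apply: cvgM; first exact: cvg_cst.
  exact: cvg_within_filter (cB p Dp).
have WM p : D p -> on_line W p <= eta * (r ^- 2 + r ^- 4).
  move=> Dp; have p0 : 0 <= p.2 by case: Dp.
  have Qp := DQ _ Dp; have Q0 := lt_le_trans r2 Qp.
  rewrite /on_line /W ler_wnDl ?w0// ler_pM2l// /B/= ger0_norm//.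
  set Q := (_ + _) in Qp Q0 *.
  have lQ : p.2 ^+ 2 <= Q by rewrite /Q lerDr sqr_ge0.
  have pg : p.2 `^ (2 * g) <= Q + 1.
    have [l1|l1] := lerP p.2 1.
      have g2 : 0 <= 2 * g by lra.
      have : p.2 `^ (2 * g) <= 1 `^ (2 * g).
        by apply: ge0_ler_powR => //; rewrite nnegrE.
      by rewrite powR1; lra.
    apply: (@le_trans _ _ (p.2 ^+ 2)); last by lra.
    rewrite -(powR_mulrn _ p0); apply: ler_powR; [exact: ltW|lra].
  apply: (@le_trans _ _ ((Q + 1) * Q ^- 2)).
    by rewrite ler_wpM2r// invr_ge0 sqr_ge0.
  have -> : (Q + 1) * Q ^- 2 = Q^-1 + (Q ^+ 2)^-1 by field; rewrite gt_eqF.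
  have r4E : r ^+ 4 = (r ^+ 2) ^+ 2 by ring.
  apply: lerD; rewrite lef_pV2 ?posrE ?exprn_gt0// r4E.
  by rewrite ler_pXn2r ?nnegrE// ltW.
have HW p : D p -> on_line W p <= 0 \/
    [/\ 0 < p.2, nbhs p D & subsol (1 - 2 * g) (on_line W) p].
  move=> Dp; have p0 : 0 <= p.2 by case: Dp.
  have := p0; rewrite le_eqVlt => /predU1P[p20|p20].
    left; rewrite /on_line /W /B/= -p20 normr0 powR0; last by rewrite gt_eqF//; lra.
    by rewrite mul0r mulr0 addr0 w0.
  have [xr|xr] := lerP `|p.1 0 0 - x1| r; last first.
    right; split=> //; last first.
      apply/subsol_on_line/planar_subsolD; first exact: sw.
      by apply/planar_subsolZ => //; exact: planar_barrier.
    apply: filterI; first exact: nbhs_closed_half_space.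
    have := @cvgr_gt R _ (nbhs p) (nbhs_filter p) _ _ (cn p) r xr.
    by apply: filterS => q /ltW; left.
  have [lr|lr] := lerP p.2 r; last first.
    right; split=> //; last first.
      apply/subsol_on_line/planar_subsolD; first exact: sw.
      by apply/planar_subsolZ => //; exact: planar_barrier.
    apply: filterI; first exact: nbhs_closed_half_space.
    have := @cvgr_gt R _ (nbhs p) (nbhs_filter p) _ _ (@snd_continuous R 1 p) r lr.
    by apply: filterS => q /ltW; right.
  left; rewrite /on_line /W; have := wr _ _ xr; move=> /(_ p.2); rewrite p0 lr => /(_ isT) wp.
  have Bp : eta * B (p.1 0 0, p.2) <= dl.
    have -> : dl = eta * (r `^ (2 * g) / r ^+ 4).
      by rewrite /eta; field; rewrite !gt_eqF.
    rewrite ler_pM2l//; apply: le_trans (Br _ _ p0 (DQ _ Dp)) _.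
    rewrite ler_pM2r ?invr_gt0//; apply: ge0_ler_powR; rewrite ?nnegrE ?(ltW r0)//; lra.
  by lra.
have {HW} main := phragmen_lindelof g01 cD _ cW WM HW.
exists (eta * (((x0 - x1) ^+ 2 + 1) ^+ 2)^-1).
  by rewrite mulr_gt0// invr_gt0 exprn_gt0// ltr_wpDl ?sqr_ge0.
move=> l /andP[l0 l1].
have /main : D (const_mx x0, l).
  by split; [exact: ltW|left; rewrite /= mxE ltW].
move=> /(_ _)-/(_ (fun p pD => pD.1)).
rewrite /on_line /W /B /= mxE gtr0_norm// => H.
have : eta * (((x0 - x1) ^+ 2 + 1) ^+ 2)^-1 * l `^ (2 * g) <=
    eta * (l `^ (2 * g) * ((x0 - x1) ^+ 2 + l ^+ 2) ^- 2).
  rewrite -mulrA ler_pM2l// mulrC ler_wpM2l ?powR_ge0//.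
  have l2 : 0 < l ^+ 2 by rewrite exprn_gt0.
  have Y0 := sqr_ge0 (x0 - x1).
  have l21 : l ^+ 2 <= 1 by rewrite expr_le1// ltW.
  rewrite lef_pV2 ?posrE ?exprn_gt0//; try lra.
  rewrite ler_pXn2r ?nnegrE//; lra.
by lra.
Qed.

(** * Layer solutions *)

Lemma trace_jetB (R : realType) (g k b c : R) (h j : R -> R) : 0 < k ->
  trace_jet g h b -> trace_jet g j c -> trace_jet g (fun l => h l - k * j l) (b - k * c).
Proof.
move=> k0 H J e e0; have e2 : 0 < e / 2 by lra.
have ek : 0 < e / 2 / k by rewrite divr_gt0.
have [d1 d10 H1] := H _ e2; have [d2 d20 J1] := J _ ek.
exists (Num.min d1 d2) => [|l]; first by rewrite lt_min d10.
rewrite lt_min => /andP[l0 /andP[l1 l2]].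
have := H1 l; rewrite l0 l1 => /(_ isT) H2; have := J1 l; rewrite l0 l2 => /(_ isT) J2.
have -> : h l - k * j l - (h 0 - k * j 0) - (b - k * c) * l `^ (2 * g) =
  (h l - h 0 - b * l `^ (2 * g)) - k * (j l - j 0 - c * l `^ (2 * g)) by ring.
apply: le_trans (ler_normB _ _) _; rewrite normrM (gtr0_norm k0).
have := ler_wpM2l (ltW k0) J2.
have -> : k * (e / 2 / k * l `^ (2 * g)) = e / 2 * l `^ (2 * g).
  by field; rewrite gt_eqF.
lra.
Qed.

Lemma trace_jet_le (R : realType) (g b c d : R) (h : R -> R) : 0 < d ->
  trace_jet g h c -> (forall l, 0 < l < d -> h l <= h 0 + b * l `^ (2 * g)) ->
  c <= b.
Proof.
move=> d0 H hb; apply/ler_addgt0Pr => e e0; have [d1 d10 H1] := H _ e0.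
pose l := Num.min d d1 / 2.
have m0 : 0 < Num.min d d1 by rewrite lt_min d0.
have l0 : 0 < l by rewrite divr_gt0.
have lm : l < Num.min d d1 by rewrite /l; lra.
have [ld ld1] : l < d /\ l < d1 by move: lm; rewrite lt_min => /andP.
have := H1 l; rewrite l0 ld1 => /(_ isT); rewrite ler_norml => /andP[+ _].
have := hb l; rewrite l0 ld => /(_ isT) A B.
by rewrite -(@ler_pM2r _ (l `^ (2 * g))) ?powR_gt0//; lra.
Qed.

(** The properties that the comparisons use, in a form inherited by - v(- x, l), so that the
    reflected layer has the same status as the original one. *)
Record layer (R : realType) (g d : R) (f : R -> R) (v : R * R -> R) : Prop := Layer {
  layer_cont : {within @closed_half_space R 1, continuous (on_line v)};
  layer_bounded : exists M, forall x l : R, 0 <= l -> `|v (x, l)| <= M;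
  layer_subsol : forall x l : R, 0 < l -> planar_subsol (1 - 2 * g) v x l /\
    planar_subsol (1 - 2 * g) (fun q => - v q) x l;
  layer_trace : forall x, trace_jet g (fun l => v (x, l)) (- f (v (x, 0)) / (2 * g * d));
  layer_incr : forall x y : R, x < y -> v (x, 0) < v (y, 0);
  layer_at0 : v (0, 0) = 0;
  layer_lt1 : forall x : R, -1 < v (x, 0) < 1;
  layer_pinfty : forall e : R, 0 < e -> exists L : R, forall x, L <= x -> 1 - e < v (x, 0);
  layer_ninfty : forall e : R, 0 < e -> exists L : R, forall x, x <= L -> v (x, 0) < -1 + e }.

Lemma trace_continuous (R : realType) (v : R * R -> R) :
  {within @closed_half_space R 1, continuous (on_line v)} ->
  continuous (fun x : R => v (x, 0)).
Proof.
move=> cv x; apply/cvgrPdist_lt => e e0.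
have [d d0 H] := on_line_trace_near x cv e0.
apply/nbhs_ballP; exists d => //= y; rewrite /ball/= distrC => xy.
by apply: H => //; rewrite lexx.
Qed.

Lemma layer_solution_layer (R : realType) (g d : R) (f : R -> R) (v : R * R -> R) :
  0 < g -> 0 < d -> layer_solution g d f v -> layer g d f v.
Proof.
move=> g0 d0 [bs dv v0 vp vm].
have mE (z : R) : (const_mx z : 'rV[R]_1) 0 0 = z by rewrite mxE.
have [[[M bM] cv Cv _] _] := bs.
have incr (x y : R) : x < y -> v (x, 0) < v (y, 0).
  move=> xy.
  have dv' z : derivable (fun z => v (z, 0)) z 1 by case: (dv z).
  have [|z _ E] := @mvt_lt R (fun z => v (z, 0)) x y x y _ (fun z _ => dv' z)
      (lexx x) xy (lexx y).
    by apply: derivable_within_continuous.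
  by rewrite -subr_gt0 E mulr_gt0 ?subr_gt0//; case: (dv z).
have lp (e : R) : 0 < e -> exists L : R, forall x, L <= x -> `|1 - v (x, 0)| < e.
  move=> e0; have /cvgrPdist_lt/(_ _ e0)[L [_ HL]] := vp.
  by exists (L + 1) => x Lx; apply: HL; lra.
have lm (e : R) : 0 < e -> exists L : R, forall x, x <= L -> `|-1 - v (x, 0)| < e.
  move=> e0; have /cvgrPdist_lt/(_ _ e0)[L [_ HL]] := vm.
  by exists (L - 1) => x Lx; apply: HL; lra.
have le1 (x : R) : v (x, 0) <= 1.
  apply/ler_addgt0Pr => e /lp[L HL].
  have := HL (Num.max L (x + 1)); rewrite le_max lexx => /(_ isT).
  have : x < Num.max L (x + 1) by rewrite lt_max; apply/orP; right; lra.
  by move=> /incr; rewrite ltr_norml; lra.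
have ge1 (x : R) : -1 <= v (x, 0).
  apply/ler_addgt0Pr => e /lm[L HL].
  have := HL (Num.min L (x - 1)); rewrite ge_min lexx => /(_ isT).
  have : Num.min L (x - 1) < x by rewrite gt_min; apply/orP; right; lra.
  by move=> /incr; rewrite ltr_norml; lra.
split => //.
- by exists M => x l l0; have := bM (const_mx x, l) l0; rewrite /on_line/= mE.
- move=> x l l0.
  have := @bounded_extension_subsol _ _ _ _ (const_mx x, l) bs.1 l0.
  rewrite (_ : (fun q => - on_line v q) = on_line (fun q => - v q))//.
  by move=> [/subsol_on_line + /subsol_on_line]; rewrite /= mE.
- move=> x; have := bounded_solution_trace_jet (const_mx x) g0 d0 bs.
  by rewrite /on_line/= mE.
- move=> x; apply/andP; split.
    by apply: le_lt_trans (ge1 (x - 1)) (incr _ _ _); lra.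
  by apply: lt_le_trans (incr _ _ _) (le1 (x + 1)); lra.
- by move=> e /lp[L HL]; exists L => x /HL; rewrite ltr_norml; lra.
- by move=> e /lm[L HL]; exists L => x /HL; rewrite ltr_norml; lra.
Qed.

Lemma coord_fst_shift_continuous (R : realType) (t : R) :
  continuous (fun p : 'rV[R]_1 * R => p.1 0 0 + t).
Proof.
apply: continuous_fctD; [exact: coord_fst_continuous|exact: cst_continuous].
Qed.

Lemma within_continuous_subM (R : realType) (T : topologicalType) (A : set T) (k : R)
    (f h : T -> R) : {within A, continuous f} -> {within A, continuous h} ->
  {within A, continuous (fun x => f x - k * h x)}.
Proof.
move=> /subspace_continuousP cf /subspace_continuousP ch.
apply/subspace_continuousP => x Ax; apply: cvgB; first exact: cf.
by apply: cvgM; [exact: cvg_cst|exact: ch].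
Qed.

Section layer_shift.
Variables (R : realType) (g d : R) (f : R -> R).
Hypothesis g01 : 0 < g < 1.

(** The factor 1 in [w] brings the difference to the form [f x - k * h x] of the lemmas on
    continuity and on traces. *)
Lemma layer_sub_shift (u v : R * R -> R) (t : R) :
  layer g d f u -> layer g d f v ->
  let w q := u q - 1 * v (q.1 + t, q.2) in
  [/\ {within @closed_half_space R 1, continuous (on_line w)},
      exists M, forall x l : R, 0 <= l -> w (x, l) <= M &
      forall x l : R, 0 < l -> planar_subsol (1 - 2 * g) w x l].
Proof.
move=> Lu Lv w; split.
- apply: within_continuous_subM; first exact: layer_cont Lu.
  apply: continuous_on_line; first exact: layer_cont Lv.
  exact: coord_fst_shift_continuous.
- have [M HM] := layer_bounded Lu; have [N HN] := layer_bounded Lv.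
  exists (M + N) => x l l0; rewrite /w mul1r.
  have := HM x l l0; have := HN (x + t) l l0.
  by rewrite !ler_norml; lra.
- move=> x l l0; have [su _] := layer_subsol Lu x l0.
  have [_ /planar_subsol_shift sv] := layer_subsol Lv (x + t) l0.
  have := planar_subsolD su sv; rewrite /w.
  by under [X in _ -> planar_subsol _ X _ _]eq_fun do rewrite mul1r.
Qed.

Lemma layer_le_of_trace (u v : R * R -> R) (t : R) :
  layer g d f u -> layer g d f v -> (forall x, u (x, 0) <= v (x + t, 0)) ->
  forall x l, 0 <= l -> u (x, l) <= v (x + t, l).
Proof.
move=> Lu Lv uv x l l0; have [cw [M wM] sw] := layer_sub_shift t Lu Lv.
have := half_plane_max g01 cw wM _ sw x l0; rewrite mul1r subr_le0; apply.
by move=> y /=; rewrite mul1r subr_le0.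
Qed.

Lemma layer_nondecreasing (u : R * R -> R) (x y l : R) :
  layer g d f u -> x <= y -> 0 <= l -> u (x, l) <= u (y, l).
Proof.
move=> Lu; rewrite -subr_ge0 => xy l0.
have -> : y = x + (y - x) by ring.
apply: layer_le_of_trace => // z.
have [->|n] := eqVneq (y - x) 0; first by rewrite addr0.
by apply/ltW/(layer_incr Lu); rewrite ltrDl lt_neqAle eq_sym n.
Qed.

End layer_shift.

Lemma layer_reflect (R : realType) (g d : R) (f : R -> R) (v : R * R -> R) :
  (forall x, -1 < x < 1 -> f (- x) = - f x) -> layer g d f v ->
  layer g d f (fun q => - v (- q.1, q.2)).
Proof.
move=> fodd Lv; split.
- have cv : {within @closed_half_space R 1, continuous
      (fun p : 'rV[R]_1 * R => v (- p.1 0 0, p.2))}.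
    apply: continuous_on_line; first exact: layer_cont Lv.
    by move=> p; apply: continuousN; exact: coord_fst_continuous.
  by move=> p; apply: continuousN; exact: cv.
- by have [M HM] := layer_bounded Lv; exists M => x l l0; rewrite normrN HM.
- move=> x l /(layer_subsol Lv (- x))[s1 s2]; split.
    exact: (@planar_subsol_reflect _ _ (fun q => - v q)).
  under eq_fun do rewrite opprK.
  exact: planar_subsol_reflect.
- move=> x /=; have := layer_trace Lv (- x).
  rewrite fodd ?(layer_lt1 Lv)// opprK => H e /H[d0 d00 Hd].
  exists d0 => // l /Hd; rewrite -normrN; congr (`|_| <= _); ring.
- by move=> x y xy /=; rewrite ltrN2; apply: (layer_incr Lv); rewrite ltrN2.
- by rewrite oppr0 (layer_at0 Lv) oppr0.
- by move=> x /=; have /andP[? ?] := layer_lt1 Lv (- x); apply/andP; split; lra.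
- move=> e /(layer_ninfty Lv)[L HL]; exists (- L) => x Lx /=.
  by have := HL (- x); rewrite lerNl => /(_ Lx); lra.
- move=> e /(layer_pinfty Lv)[L HL]; exists (- L) => x Lx /=.
  by have := HL (- x); rewrite lerNr => /(_ Lx); lra.
Qed.

Lemma vanishing_pos_argmax (R : realType) (h : R -> R) (x : R) : continuous h ->
  (forall e : R, 0 < e -> exists L, forall y, L <= `|y| -> h y <= e) -> 0 < h x ->
  exists2 z, 0 < h z & forall y, h y <= h z.
Proof.
move=> ch hv hx; have [L HL] := hv _ hx.
pose K := Num.max (Num.max L `|x|) 0.
have K0 : 0 <= K by rewrite le_max lexx orbT.
have LK : L <= K by rewrite !le_max lexx.
have xK : `|x| <= K by rewrite !le_max lexx !orbT.
have [||z _ Hz] := @EVT_max R h (- K) K; first lra.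
  by apply: continuous_subspaceT.
have xz : h x <= h z by apply: Hz; rewrite in_itv/= -ler_norml.
exists z; first exact: lt_le_trans xz.
move=> y; have [yK|Ky] := lerP `|y| K.
  by apply: Hz; rewrite in_itv/= -ler_norml.
by apply: le_trans (HL y _) xz; rewrite (le_trans LK)// ltW.
Qed.

(** * Sliding two layers along each other *)

Section sliding.
Variables (R : realType) (g d : R) (f : R -> R) (c : R).
Hypothesis g01 : 0 < g < 1.
Hypothesis d0 : 0 < d.
Hypothesis fodd : forall x, -1 < x < 1 -> f (- x) = - f x.
Hypothesis c01 : 0 < c < 1.
Hypothesis fdecr : forall x y : R, c <= x -> x < y -> y <= 1 -> f y < f x.

(** If the trace of u - v(. + t) were positive somewhere, it would attain a positive maximum, which
    by the maximum principle is one over the whole half-plane; the flux there gives f(v) <= f(u)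
    with v < u. This is impossible when both are at most - c or both at least c, where f strictly
    decreases, and the last hypothesis covers the remaining bounded range. *)
Lemma slide_le (u v : R * R -> R) (t L : R) :
  layer g d f u -> layer g d f v ->
  (forall x, x < - L -> u (x, 0) <= - c) ->
  (forall x, L < x -> c <= v (x, 0)) ->
  (forall x, - L <= x -> x + t <= L -> u (x, 0) <= v (x + t, 0)) ->
  forall x, u (x, 0) <= v (x + t, 0).
Proof.
move=> Lu Lv uL vL H x; rewrite leNgt; apply/negP => uvx.
have gd : 0 < 2 * g * d by rewrite !mulr_gt0//; case/andP: g01.
have [cw [M wM] sw] := layer_sub_shift t Lu Lv.
set w := (fun q => _) in cw wM sw.
have [z wz Hz] : exists2 z, 0 < w (z, 0) & forall y, w (y, 0) <= w (z, 0).
  apply: (@vanishing_pos_argmax _ (fun y => w (y, 0)) x).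
  - exact: trace_continuous.
  - move=> e e0; have [L1 H1] := layer_pinfty Lv e0.
    have [L2 H2] := layer_ninfty Lu e0.
    exists (Num.max 0 (Num.max (L1 - t) (- L2))) => y; rewrite !ge_max => /and3P[_ y1 y2].
    rewrite /w mul1r; have := layer_lt1 Lu y; have := layer_lt1 Lv (y + t).
    have [y0|y0] := lerP 0 y.
      rewrite (ger0_norm y0) in y1.
      have := H1 (y + t); rewrite -lerBlDr => /(_ y1); lra.
    rewrite (ltr0_norm y0) lerN2 in y2.
    by have := H2 y y2; lra.
  - by rewrite /w mul1r subr_gt0.
have wzl l : 0 <= l -> w (z, l) <= w (z, 0).
  move=> l0; pose w' q := w q + - 1 * w (z, 0).
  have : w' (z, l) <= 0.
    apply: (@half_plane_max R g (M - w (z, 0)) w' g01) => //.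
    - rewrite (_ : on_line w' = fun p => on_line w p - 1 * w (z, 0)); last first.
        by apply/funext => p; rewrite /on_line /w' mulNr.
      apply: (@within_continuous_subM _ _ _ 1 (on_line w) (fun=> w (z, 0))) => //.
      by apply: continuous_subspaceT; exact: cst_continuous.
    - by move=> y s s0; rewrite /w' mulN1r lerB// wM.
    - by move=> y; rewrite /w' mulN1r subr_le0.
    - move=> y s s0; have [b [b' [bl [bl' [S1 S2 S3]]]]] := sw y s s0.
      have cst0 : lower_jet (fun=> - 1 * w (z, 0) : R) 0 0.
        by apply: lower_jet_quad => r; rewrite !(mul0r, addr0).
      exists (b + 0), (b' + 0), (bl + 0), (bl' + 0).
      by split; [exact: lower_jetD|exact: lower_jetD|rewrite !addr0].
  by rewrite /w' mulN1r subr_le0.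
have wt := trace_jetB ltr01 (layer_trace Lu z) (layer_trace Lv (z + t)).
have := trace_jet_le (b := 0) ltr01 wt; rewrite !mul1r => /(_ _).
have Hw l : 0 < l < 1 -> u (z, l) - v (z + t, l) <=
    u (z, 0) - v (z + t, 0) + 0 * l `^ (2 * g).
  by case/andP=> l0 _; have := wzl l (ltW l0); rewrite /w !mul1r mul0r addr0.
have {wt wzl} A : - f (u (z, 0)) / (2 * g * d) - - f (v (z + t, 0)) / (2 * g * d) <= 0 ->
    f (v (z + t, 0)) <= f (u (z, 0)).
  by rewrite -mulrBl pmulr_lle0 ?invr_gt0//; lra.
move=> B; have {A B} fle : f (v (z + t, 0)) <= f (u (z, 0)).
  by apply: A; apply: B => l /Hw; rewrite !mul1r.
move: wz; rewrite /w mul1r subr_gt0 => vu.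
have /andP[u1 u2] := layer_lt1 Lu z; have /andP[v1 v2] := layer_lt1 Lv (z + t).
have [zL|zL] := ltrP z (- L).
  have uc := uL z zL.
  have : f (- v (z + t, 0)) < f (- u (z, 0)) by apply: fdecr; lra.
  by rewrite !fodd ?u1 ?v1//; lra.
have [ztL|ztL] := ltrP L (z + t).
  have : f (u (z, 0)) < f (v (z + t, 0)) by apply: fdecr; [exact: vL|lra|lra].
  by lra.
by have := H z zL ztL; lra.
Qed.

(** At a contact point the traces agree, hence so do the values of f and the fluxes, whereas the
    Hopf lemma makes the flux of the difference nonzero. The normalisation u(0, 0) = v(0, 0) = 0
    with t > 0 provides the point where the difference is negative. *)
Lemma slide_lt (u v : R * R -> R) (t x : R) :
  layer g d f u -> layer g d f v -> 0 < t ->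
  (forall x, u (x, 0) <= v (x + t, 0)) -> u (x, 0) < v (x + t, 0).
Proof.
move=> Lu Lv t0 uv; rewrite lt_neqAle uv andbT; apply/eqP => E.
have [cw _ sw] := layer_sub_shift t Lu Lv.
set w := (fun q => _) in cw sw.
have w0 (y l : R) : 0 <= l -> w (y, l) <= 0.
  by move=> l0; rewrite /w mul1r subr_le0; apply: (layer_le_of_trace g01 Lu Lv).
have w00 : w (0, 0) < 0.
  have := layer_incr Lv t0; rewrite (layer_at0 Lv) => vt.
  by rewrite /w mul1r subr_lt0 add0r (layer_at0 Lu).
have wx : w (x, 0) = 0 by rewrite /w mul1r E subrr.
have x0 : x != 0 by apply/eqP => x0; rewrite x0 in wx; rewrite wx ltxx in w00.
have [b b0 Hb] := hopf g01 cw w0 sw w00 x0.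
have wt := trace_jetB ltr01 (layer_trace Lu x) (layer_trace Lv (x + t)).
have : - f (u (x, 0)) / (2 * g * d) - 1 * (- f (v (x + t, 0)) / (2 * g * d)) <= - b.
  apply: (trace_jet_le ltr01 wt) => l /Hb; rewrite /w /= !mul1r E.
  by rewrite subrr add0r.
by rewrite E mul1r subrr; lra.
Qed.

Lemma layer_trace_le (u v : R * R -> R) (x : R) :
  layer g d f u -> layer g d f v -> u (x, 0) <= v (x, 0).
Proof.
move=> Lu Lv.
have c1 : 0 < 1 - c by case/andP: c01 => *; lra.
have [L1 HL1] := layer_pinfty Lv c1.
have [L2 HL2] := layer_ninfty Lu c1.
pose L := Num.max 0 (Num.max L1 (- L2)).
have L0 : 0 <= L by rewrite le_max lexx.
have uL y : y < - L -> u (y, 0) <= - c.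
  move=> yL; have : y <= L2.
    rewrite -lerN2; apply: le_trans (_ : L <= _); last lra.
    by rewrite !le_max lexx !orbT.
  by move=> /HL2; lra.
have vL y : L < y -> c <= v (y, 0).
  move=> yL; have : L1 <= y.
    by apply: le_trans (ltW yL); rewrite !le_max lexx !orbT.
  by move=> /HL1; lra.
pose T : set R := [set t | 0 <= t /\ forall y, u (y, 0) <= v (y + t, 0)].
(* For this shift no y satisfies both - L <= y and y + t <= L, so the middle range of [slide_le] is
   empty. *)
have T1 : T (2 * L + 1).
  split; first by lra.
  by apply: (slide_le Lu Lv uL vL) => y; lra.
have infT : has_inf T by split; [exists (2 * L + 1)|exists 0 => t []].
have s0 : 0 <= inf T by apply: lb_le_inf; [exists (2 * L + 1)|move=> t []].
have sT y : u (y, 0) <= v (y + inf T, 0).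
  rewrite leNgt; apply/negP => H.
  have e0 : 0 < u (y, 0) - v (y + inf T, 0) by lra.
  have [e ee He] := on_line_trace_near (y + inf T) (layer_cont Lv) e0.
  have [t [t0 Tt] te] := inf_adherent ee infT.
  have tT : inf T <= t by apply: ge_inf => //; case: infT.
  have := He (y + t) 0; rewrite lexx ee => /(_ _ isT).
  have -> : y + t - (y + inf T) = t - inf T by ring.
  rewrite ger0_norm ?subr_ge0// ltrBlDl => /(_ te).
  by have := Tt y; rewrite ltr_norml; lra.
suff sE : inf T = 0 by have := sT x; rewrite sE addr0.
apply/eqP; rewrite eq_le s0 andbT leNgt; apply/negP => sp.
have cu := trace_continuous (layer_cont Lu).
have cv := trace_continuous (layer_cont Lv).
pose P (t y : R) := u (y, 0) < v (y + t, 0).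
(* The strict inequality on the compact interval [- L, L] persists for all shifts near [inf T]; for
   a shift t >= 0, [slide_le] asks for nothing outside this interval. *)
have nearP : \forall t \near inf T, `[- L, L]%classic `<=` P t.
  have nc := iffLR (compact_near_coveringP _) (@segment_compact R (- L) L).
  apply: (nc R (nbhs (inf T)) P (nbhs_filter _)) => y _.
  have lt0 : 0 < v (y + inf T, 0) - u (y, 0) by rewrite subr_gt0; exact: slide_lt.
  have cvu : {for (y, inf T), continuous (fun q : R * R => v (q.1 + q.2, 0) - u (q.1, 0))}.
    apply: continuousB.
      apply: (@continuous_comp _ R R (fun q : R * R => q.1 + q.2) (fun z => v (z, 0))).
        exact: add_continuous.
      exact: cv.
    apply: (@continuous_comp _ R R fst (fun z => u (z, 0))); first exact: cvg_fst.
    exact: cu.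
  have := @cvgr_gt R _ _ (nbhs_filter _) _ _ cvu 0 lt0.
  by apply: filterS => -[a b]; rewrite subr_gt0.
have [e /= e0 He] := iffLR (nbhs_ballP _ _) nearP.
pose t := Num.max 0 (inf T - e / 2).
have ts : t < inf T by rewrite gt_max sp/=; lra.
have tb : ball (inf T) e t.
  rewrite /ball/= ger0_norm ?subr_ge0 ?ltW//.
  have : inf T - e / 2 <= t by rewrite le_max lexx orbT.
  lra.
have t0 : 0 <= t by rewrite le_max lexx.
have : T t.
  split => //; apply: (slide_le Lu Lv uL vL) => y y1 y2.
  by apply/ltW/(He _ tb); rewrite /= in_itv/=; apply/andP; split; lra.
by move=> /(ge_inf infT.2); lra.
Qed.

(** The reflected function is again a layer, as f is odd; comparison both ways identifies the traces
    and then the functions. In particular u(0, l) = 0 at every height. *)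
Lemma layer_odd (u : R * R -> R) (x l : R) : layer g d f u -> 0 <= l ->
  u (- x, l) = - u (x, l).
Proof.
move=> Lu l0; have Lr := layer_reflect fodd Lu.
apply/eqP; rewrite eq_le; apply/andP; split.
  have := layer_le_of_trace (t := 0) g01 Lu Lr _ (- x) l0.
  rewrite /= addr0 opprK; apply => y; rewrite addr0; exact: (layer_trace_le y Lu Lr).
have := layer_le_of_trace (t := 0) g01 Lr Lu _ (- x) l0.
rewrite /= addr0 opprK; apply => y; rewrite addr0; exact: (layer_trace_le y Lr Lu).
Qed.

End sliding.

(** * The Simons cone *)

Lemma enorm_ge0 (R : realType) (n : nat) (x : 'rV[R]_n) : 0 <= enorm x.
Proof. exact: sqrtr_ge0. Qed.

Lemma sqr_enorm (R : realType) (n : nat) (x : 'rV[R]_n) :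
  enorm x ^+ 2 = \sum_i x 0 i ^+ 2.
Proof. by rewrite sqr_sqrtr// sumr_ge0// => i _; exact: sqr_ge0. Qed.

(** When x = 0 a coordinate vector serves as direction, whence the positive dimension; points with
    x'' = 0 then require no separate treatment. *)
Lemma enorm_polar (R : realType) (n : nat) (x : 'rV[R]_n.+1) :
  exists2 b : 'rV[R]_n.+1, x = enorm x *: b & \sum_i b 0 i ^+ 2 = 1.
Proof.
have [x0|x0] := eqVneq (enorm x) 0.
  exists (delta_mx 0 0).
    rewrite x0 scale0r; apply/rowP => i; rewrite mxE.
    have := sqr_enorm x; rewrite x0 expr0n/= => /esym/eqP.
    rewrite psumr_eq0 => [/allP/(_ i)|j _]; last exact: sqr_ge0.
    by rewrite mem_index_enum => /(_ isT)/=; rewrite sqrf_eq0 => /eqP.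
  rewrite (bigD1 0)//= mxE !eqxx big1 ?addr0 ?expr1n// => i i0.
  by rewrite mxE (negbTE i0) andbF expr0n.
exists ((enorm x)^-1 *: x).
  by rewrite scalerA mulfV// scale1r.
under eq_bigr do rewrite mxE exprMn.
by rewrite -mulr_sumr -sqr_enorm -exprMn mulVf// expr1n.
Qed.

Lemma enorm_scale_unit (R : realType) (n : nat) (k : R) (b : 'rV[R]_n) :
  0 <= k -> \sum_i b 0 i ^+ 2 = 1 -> enorm (k *: b) = k.
Proof.
move=> k0 b1; rewrite /enorm; under eq_bigr do rewrite mxE exprMn.
by rewrite -mulr_sumr b1 mulr1 sqrtr_sqr ger0_norm.
Qed.

Lemma enorm_dist_le (R : realType) (n : nat) (x y : 'rV[R]_n.+1) :
  (enorm x - enorm y) ^+ 2 <= enorm (x - y) ^+ 2.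
Proof.
have [a xE a1] := enorm_polar x; have [b yE b1] := enorm_polar y.
set s := enorm x in xE *; set t := enorm y in yE *.
rewrite sqr_enorm xE yE.
have ab : \sum_i a 0 i * b 0 i <= 1.
  have : 0 <= \sum_i (a 0 i - b 0 i) ^+ 2 by apply: sumr_ge0 => i _; exact: sqr_ge0.
  have -> : \sum_i (a 0 i - b 0 i) ^+ 2 =
      \sum_i a 0 i ^+ 2 + \sum_i b 0 i ^+ 2 - 2 * \sum_i a 0 i * b 0 i.
    by rewrite mulr_sumr -sumrN -!big_split/=; apply: eq_bigr => i _; ring.
  by rewrite a1 b1; lra.
have -> : \sum_i (s *: a - t *: b) 0 i ^+ 2 =
    s ^+ 2 * (\sum_i a 0 i ^+ 2) + t ^+ 2 * (\sum_i b 0 i ^+ 2) -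
    2 * s * t * \sum_i a 0 i * b 0 i.
  rewrite !mulr_sumr -sumrN -!big_split/=; apply: eq_bigr => i _.
  by rewrite !mxE; ring.
rewrite a1 b1.
have : 0 <= s * t * (1 - \sum_i a 0 i * b 0 i).
  by rewrite !mulr_ge0 ?enorm_ge0 ?subr_ge0.
lra.
Qed.

(** The root is |x' + r e_j| with s = |x'| and al = x'_j / s, whose second derivative at r = 0 is (1
    - al^2) / s. A curvature h strictly above 1 / s leaves the margin s h - 1 to absorb the
    remainder, so the bound holds exactly near 0. *)
Lemma sqrt_upper (R : realType) (s al h : R) : 0 < s -> 1 < s * h ->
  al ^+ 2 <= 1 -> exists2 dl : R, 0 < dl & forall r : R, `|r| < dl ->
    Num.sqrt (s ^+ 2 + 2 * (s * al) * r + r ^+ 2) <=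
    s + al * r + h * (1 - al ^+ 2) / 2 * r ^+ 2.
Proof.
move=> s0 sh al1; have h0 : 0 < h by rewrite -(pmulr_rgt0 _ s0); lra.
have alb : -1 <= al <= 1 by rewrite -ler_norml -(@expr_le1 _ 2)// real_normK ?num_real.
exists (Num.min s ((s * h - 1) / h)) => [|r].
  by rewrite lt_min s0 divr_gt0//; lra.
rewrite lt_min ltr_pdivlMr// => /andP[rs rh].
have ar : `|al * r| <= `|r| by rewrite normrM ler_piMl// ler_norml.
have arh : `|al * r| * h <= `|r| * h by rewrite ler_wpM2r// ltW.
have q0 : 0 <= h * (1 - al ^+ 2) / 2 * r ^+ 2.
  by rewrite mulr_ge0 ?sqr_ge0// divr_ge0// mulr_ge0 ?subr_ge0// ltW.
set B := (X in _ <= X).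
have B0 : 0 <= B by rewrite /B; have := ar; rewrite ler_norml => /andP[]; lra.
rewrite -(ger0_norm B0) -sqrtr_sqr ler_wsqrtr// -subr_ge0.
have -> : B ^+ 2 - (s ^+ 2 + 2 * (s * al) * r + r ^+ 2) =
  r ^+ 2 * (1 - al ^+ 2) * (s * h - 1 + al * r * h + h ^+ 2 * (1 - al ^+ 2) * r ^+ 2 / 4).
  by rewrite /B; field.
have : 0 <= h ^+ 2 * (1 - al ^+ 2) * r ^+ 2 / 4.
  by rewrite divr_ge0// mulr_ge0 ?sqr_ge0// mulr_ge0 ?sqr_ge0 ?subr_ge0.
have X : 0 <= r ^+ 2 * (1 - al ^+ 2) by rewrite mulr_ge0 ?sqr_ge0 ?subr_ge0.
move=> H; apply: (mulr_ge0 X).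
have : - (`|al * r| * h) <= al * r * h.
  by rewrite -mulNr ler_wpM2r ?(ltW h0)// lerNl -normrN ler_norm.
lra.
Qed.

(** The counterpart with h < 1 / t; for t = 0 the root is |r| and every h > 0 is allowed. *)
Lemma sqrt_lower (R : realType) (t be h : R) : 0 <= t -> 0 < h -> t * h < 1 ->
  be ^+ 2 <= 1 -> exists2 dl : R, 0 < dl & forall r : R, `|r| < dl ->
    t + be * r + h * (1 - be ^+ 2) / 2 * r ^+ 2 <=
    Num.sqrt (t ^+ 2 + 2 * (t * be) * r + r ^+ 2).
Proof.
move=> t0 h0 th be1.
have beb : -1 <= be <= 1 by rewrite -ler_norml -(@expr_le1 _ 2)// real_normK ?num_real.
exists ((1 - t * h) / 2 / h) => [|r].
  by rewrite !divr_gt0//; lra.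
rewrite ltr_pdivlMr// => rh.
have br : `|be * r| <= `|r| by rewrite normrM ler_piMl// ler_norml.
have brh : `|be * r| * h <= `|r| * h by rewrite ler_wpM2r// ltW.
set B := (X in X <= _).
apply: le_trans (ler_norm _) _; rewrite -sqrtr_sqr ler_wsqrtr// -subr_le0.
have -> : B ^+ 2 - (t ^+ 2 + 2 * (t * be) * r + r ^+ 2) =
  r ^+ 2 * (1 - be ^+ 2) * (t * h - 1 + be * r * h + h ^+ 2 * (1 - be ^+ 2) * r ^+ 2 / 4).
  by rewrite /B; field.
have X : 0 <= r ^+ 2 * (1 - be ^+ 2) by rewrite mulr_ge0 ?sqr_ge0 ?subr_ge0.
apply: (mulr_ge0_le0 X).
have : be * r * h <= `|be * r| * h by rewrite ler_wpM2r ?(ltW h0)// ler_norm.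
have : h ^+ 2 * (1 - be ^+ 2) * r ^+ 2 <= (`|r| * h) ^+ 2.
  rewrite exprMn real_normK ?num_real//.
  have := mulr_ge0 (sqr_ge0 h) (mulr_ge0 (sqr_ge0 be) (sqr_ge0 r)); lra.
have th0 : 0 <= t * h by rewrite mulr_ge0// ltW.
have rh0 : 0 <= `|r| * h by rewrite mulr_ge0// ltW.
nra.
Qed.

Lemma enorm_line (R : realType) (n : nat) (y b : 'rV[R]_n) (j : 'I_n) (r : R) :
  y = enorm y *: b ->
  enorm (y + r *: delta_mx 0 j) =
  Num.sqrt (enorm y ^+ 2 + 2 * (enorm y * b 0 j) * r + r ^+ 2).
Proof.
move=> yE; rewrite {1}/enorm; congr Num.sqrt; rewrite sqr_enorm.
rewrite (bigD1 j)//= [in RHS](bigD1 j)//= !mxE !eqxx/=.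
rewrite (eq_bigr (fun i => y 0 i ^+ 2)) => [|i ij]; last first.
  by rewrite !mxE eqxx/= (negbTE ij) mulr0 addr0.
have -> : enorm y * b 0 j = y 0 j by rewrite [in RHS]yE mxE.
ring.
Qed.

Lemma enorm_continuous (R : realType) (n : nat) (T : topologicalType)
    (h : T -> 'rV[R]_n) : (forall i, continuous (fun x => h x 0 i)) ->
  continuous (fun x => enorm (h x)).
Proof.
move=> ch x; rewrite /enorm.
apply: (@continuous_comp _ R R (fun y => \sum_i h y 0 i ^+ 2) Num.sqrt).
  apply: continuous_big => [|i _]; first exact: add_continuous.
  exact: continuous_fctX.
exact: sqrt_continuous.
Qed.

Section cone.
Variables (R : realType) (m : nat).
Implicit Types (x : 'rV[R]_(m + m)).

Lemma radius_s_continuous : continuous (fun p : 'rV[R]_(m + m) * R => radius_s p.1).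
Proof.
apply: enorm_continuous => i; under eq_fun do rewrite mxE.
exact: coord_fst_continuous.
Qed.

Lemma radius_t_continuous : continuous (fun p : 'rV[R]_(m + m) * R => radius_t p.1).
Proof.
apply: enorm_continuous => i; under eq_fun do rewrite mxE.
exact: coord_fst_continuous.
Qed.

Lemma radius_s_lshift x (j : 'I_m) (r : R) :
  radius_s (x + r *: delta_mx 0 (lshift m j)) = enorm (lsubmx x + r *: delta_mx 0 j).
Proof.
by congr enorm; apply/rowP => i; rewrite !mxE !eqxx/= eq_lshift.
Qed.

Lemma radius_t_lshift x (j : 'I_m) (r : R) :
  radius_t (x + r *: delta_mx 0 (lshift m j)) = radius_t x.
Proof.
by congr enorm; apply/rowP => i; rewrite !mxE eq_rlshift andbF mulr0 addr0.
Qed.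

Lemma radius_s_rshift x (j : 'I_m) (r : R) :
  radius_s (x + r *: delta_mx 0 (rshift m j)) = radius_s x.
Proof.
by congr enorm; apply/rowP => i; rewrite !mxE eq_lrshift andbF mulr0 addr0.
Qed.

Lemma radius_t_rshift x (j : 'I_m) (r : R) :
  radius_t (x + r *: delta_mx 0 (rshift m j)) = enorm (rsubmx x + r *: delta_mx 0 j).
Proof.
by congr enorm; apply/rowP => i; rewrite !mxE !eqxx/= eq_rshift.
Qed.

Definition cone_coord (p : 'rV[R]_(m + m) * R) : R :=
  (radius_s p.1 - radius_t p.1) / Num.sqrt 2.

Lemma cone_coord_continuous : continuous cone_coord.
Proof.
rewrite /cone_coord; under eq_fun do rewrite mulrC.
apply/continuous_fctZ/continuous_fctD; first exact: radius_s_continuous.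
by move=> p; apply: cvgN; exact: radius_t_continuous.
Qed.

End cone.

Lemma enorm_split (R : realType) (m : nat) (x : 'rV[R]_(m + m)) :
  enorm x ^+ 2 = enorm (lsubmx x) ^+ 2 + enorm (rsubmx x) ^+ 2.
Proof.
by rewrite !sqr_enorm big_split_ord/=; congr (_ + _); apply: eq_bigr => i _; rewrite mxE.
Qed.

(** For y on the cone with common radius q, the reverse triangle inequality in each factor gives |x
    - y|^2 >= (s - q)^2 + (t - q)^2 >= (s - t)^2 / 2. Equality holds for q = (s + t) / 2 and y', y''
    in the directions of x', x''. *)
Lemma eucl_dist_cone (R : realType) (m : nat) (x : 'rV[R]_(m.+1 + m.+1)) :
  eucl_dist x (@simons_cone R m.+1) = `|radius_s x - radius_t x| / Num.sqrt 2.
Proof.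
set s := radius_s x; set t := radius_t x.
have s2 : 0 < Num.sqrt (2 : R) by rewrite sqrtr_gt0.
have sq2 : Num.sqrt (2 : R) ^+ 2 = 2 by rewrite sqr_sqrtr.
pose E := [set enorm (x - y) | y in @simons_cone R m.+1].
have lb : lbound E (`|s - t| / Num.sqrt 2).
  move=> _ [y yC <-]; rewrite -(@ler_pXn2r _ 2) ?nnegrE ?enorm_ge0 ?divr_ge0 ?(ltW s2)//.
  rewrite expr_div_n sq2 real_normK ?num_real// enorm_split.
  have -> : lsubmx (x - y) = lsubmx x - lsubmx y by rewrite linearB.
  have -> : rsubmx (x - y) = rsubmx x - rsubmx y by rewrite linearB.
  have := enorm_dist_le (lsubmx x) (lsubmx y).
  have := enorm_dist_le (rsubmx x) (rsubmx y).
  move: yC; rewrite /simons_cone/= /radius_s /radius_t => ->.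
  rewrite -/(radius_s x) -/(radius_t x) -/s -/t; set q := enorm (rsubmx y).
  have := sqr_ge0 (s + t - 2 * q); lra.
have [a xa a1] := enorm_polar (lsubmx x); have [b xb b1] := enorm_polar (rsubmx x).
rewrite -/(radius_s x) -/s in xa; rewrite -/(radius_t x) -/t in xb.
have st0 : 0 <= (s + t) / 2 by rewrite divr_ge0// addr_ge0// enorm_ge0.
pose y : 'rV[R]_(m.+1 + m.+1) := row_mx ((s + t) / 2 *: a) ((s + t) / 2 *: b).
have Ey : E (`|s - t| / Num.sqrt 2).
  exists y.
    by rewrite /simons_cone/= /radius_s /radius_t row_mxKl row_mxKr !enorm_scale_unit.
  apply/eqP; rewrite -(@eqrXn2 _ 2) ?enorm_ge0 ?divr_ge0 ?(ltW s2)//; apply/eqP.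
  rewrite expr_div_n sq2 real_normK ?num_real// enorm_split !linearB/=.
  rewrite row_mxKl row_mxKr xa xb -!scalerBl !sqr_enorm.
  under eq_bigr do rewrite mxE exprMn.
  under [X in _ + X]eq_bigr do rewrite mxE exprMn.
  by rewrite -!mulr_sumr a1 b1; field.
apply/eqP; rewrite eq_le; apply/andP; split.
  by apply: ge_inf => //; exists (`|s - t| / Num.sqrt 2).
by apply: lb_le_inf => //; exists (`|s - t| / Num.sqrt 2).
Qed.

(* The distance to the cone is bounded above, to second order along each
   coordinate line, by z + sg r + kp r^2 / 2 with sum sg^2 = 1 and sum kp = 0:
   the curvatures 1/s <= 1/t of the spheres |x'| = s and |x''| = t are both
   replaced by the intermediate value h = 2 / (s + t), which also covers t = 0,
   where |x''| is not differentiable. *)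
Lemma subsol_layer_of_cone (R : realType) (m : nat) (a tau : R) (v : R * R -> R)
    (p : 'rV[R]_(m.+1 + m.+1) * R) :
  (forall x y, x <= y -> v (x, p.2) <= v (y, p.2)) ->
  radius_t p.1 < radius_s p.1 ->
  planar_subsol a (fun q => - v q) (cone_coord p + tau) p.2 ->
  subsol a (fun q => - v (cone_coord q + tau, q.2)) p.
Proof.
case: p => x l /= vm ts [b [c [bl [cl [vx vl vS]]]]].
have [al xa a1] := enorm_polar (lsubmx x); have [be xb b1] := enorm_polar (rsubmx x).
have t0 : 0 <= radius_t x by exact: enorm_ge0.
have s0 : 0 < radius_s x by exact: le_lt_trans ts.
set s := radius_s x in ts s0; set t := radius_t x in ts t0.
pose h := 2 / (s + t).
have st0 : 0 < s + t by lra.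
have h0 : 0 < h by rewrite divr_gt0.
have sh : 1 < s * h by rewrite /h mulrA ltr_pdivlMr//; lra.
have th : t * h < 1 by rewrite /h mulrA ltr_pdivrMr//; lra.
pose k := (Num.sqrt (2 : R))^-1.
have k0 : 0 < k by rewrite invr_gt0 sqrtr_gt0.
have k2 : k ^+ 2 = 2^-1 by rewrite /k exprVn sqr_sqrtr.
have unit_le (e : 'rV[R]_m.+1) j : \sum_i e 0 i ^+ 2 = 1 -> e 0 j ^+ 2 <= 1.
  by move=> <-; rewrite (bigD1 j)//= lerDl sumr_ge0// => i _; exact: sqr_ge0.
pose sg (i : 'I_(m.+1 + m.+1)) : R :=
  match fintype.split i with inl j => k * al 0 j | inr j => - k * be 0 j end.
pose kp (i : 'I_(m.+1 + m.+1)) : R :=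
  match fintype.split i with
  | inl j => k * (h * (1 - al 0 j ^+ 2))
  | inr j => - k * (h * (1 - be 0 j ^+ 2)) end.
exists (fun i => b * sg i), (fun i => c * sg i ^+ 2 + b * kp i), bl, cl.
split => [i||].
- have cmp := lower_jet_comp (sg i) (kp i) vx.
  suff [dl dl0 Hdl] : exists2 dl : R, 0 < dl & forall r : R, `|r| < dl ->
      cone_coord (x + r *: delta_mx 0 i, l) <=
      cone_coord (x, l) + (sg i * r + kp i / 2 * r ^+ 2).
    (* As v is nondecreasing in x, an upper bound for the signed distance is a lower bound for -
       v. *)
    apply: lower_jet_le cmp; first exact: dl0.
      by rewrite scale0r addr0 expr0n/= !mulr0 !addr0.
    move=> r /Hdl; rewrite lerN2 => H; apply: vm.
    by rewrite addrAC lerD2r.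
  rewrite /sg /kp /cone_coord/= -/k; case: split_ordP => j ->.
    have [dl dl0 Hdl] := sqrt_upper s0 sh (unit_le al j a1).
    exists dl => // r /Hdl; rewrite radius_t_lshift radius_s_lshift.
    rewrite (enorm_line _ _ xa) -/(radius_s x) -/s -/t => H.
    have := ler_wpM2l (ltW k0) H; lra.
  have [dl dl0 Hdl] := sqrt_lower t0 h0 th (unit_le be j b1).
  exists dl => // r /Hdl; rewrite radius_t_rshift radius_s_rshift.
  rewrite (enorm_line _ _ xb) -/(radius_t x) -/s -/t => H.
  have := ler_wpM2l (ltW k0) H; lra.
- by [].
have Ssg : \sum_i sg i ^+ 2 = 1.
  rewrite big_split_ord/= /sg.
  under eq_bigr do rewrite (unsplitK (inl _)) exprMn.
  under [X in _ + X]eq_bigr do rewrite (unsplitK (inr _)) exprMn sqrrN.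
  by rewrite -!mulr_sumr a1 b1 k2; lra.
(* The two factors contribute opposite multiples of k h, equal in size because they have the same
   dimension. *)
have Skp : \sum_i kp i = 0.
  rewrite big_split_ord/= /kp.
  under eq_bigr do rewrite (unsplitK (inl _)) mulrA mulrBr mulr1.
  under [X in _ + X]eq_bigr do rewrite (unsplitK (inr _)) mulrA mulrBr mulr1.
  by rewrite !sumrB -!mulr_sumr a1 b1 !sumr_const !card_ord; ring.
by rewrite big_split/= -!mulr_sumr Ssg Skp mulr1 mulr0 addr0.
Qed.

(** * Comparison on one side of the cone *)

Section saddle.
Variables (R : realType) (g d : R) (f : R -> R) (m : nat).
Variables (u : 'rV[R]_(m.+1 + m.+1) * R -> R) (v : R * R -> R).
Hypothesis g01 : 0 < g < 1.
Hypothesis d0 : 0 < d.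
Hypothesis bu : bounded_solution g d f u.
Hypothesis u1 : forall p, closed_half_space p -> `|u p| < 1.
Hypothesis ucone : forall x (l : R), 0 <= l -> radius_s x = radius_t x -> u (x, l) = 0.
Hypothesis Lv : layer g d f v.
Hypothesis v_odd : forall x l : R, 0 <= l -> v (- x, l) = - v (x, l).

Definition cone_side : set ('rV[R]_(m.+1 + m.+1) * R) :=
  [set p | 0 <= p.2 /\ radius_t p.1 <= radius_s p.1].

Lemma cone_gap_continuous :
  continuous (fun p : 'rV[R]_(m.+1 + m.+1) * R => radius_s p.1 - radius_t p.1).
Proof.
apply: continuous_fctD; first exact: radius_s_continuous.
by move=> p; apply: cvgN; exact: radius_t_continuous.
Qed.

Lemma closed_cone_side : closed cone_side.
Proof.
have -> : cone_side = @closed_half_space R _ `&`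
    [set p : 'rV[R]_(m.+1 + m.+1) * R | 0 <= radius_s p.1 - radius_t p.1].
  by apply/seteqP; split => p [p0]; rewrite /= ?subr_ge0.
apply: closedI; first exact: closed_closed_half_space.
apply: (@closed_comp _ _ (fun p : 'rV[R]_(m.+1 + m.+1) * R =>
  radius_s p.1 - radius_t p.1) [set y | 0 <= y]) => [p _|].
  exact: cone_gap_continuous.
exact: closed_ge.
Qed.

Lemma nbhs_cone_side (p : 'rV[R]_(m.+1 + m.+1) * R) :
  0 < p.2 -> radius_t p.1 < radius_s p.1 -> nbhs p cone_side.
Proof.
move=> p0; rewrite -subr_gt0 => st.
have H1 := nbhs_closed_half_space p0.
have H2 := @cvgr_gt R _ (nbhs p) (nbhs_filter p) _ _ (@cone_gap_continuous p) 0 st.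
apply: filterS2 H1 H2 => q q0 /ltW; rewrite subr_ge0; by split.
Qed.

Lemma cone_coord_ge0 (p : 'rV[R]_(m.+1 + m.+1) * R) :
  radius_t p.1 <= radius_s p.1 -> 0 <= cone_coord p.
Proof. by move=> ts; rewrite divr_ge0 ?subr_ge0// sqrtr_ge0. Qed.

Definition gap (k tau : R) (p : 'rV[R]_(m.+1 + m.+1) * R) : R :=
  u p - k * v (cone_coord p + tau, p.2).

Lemma gap_continuous (k tau : R) : {within cone_side, continuous (gap k tau)}.
Proof.
have sub : cone_side `<=` @closed_half_space R _ by move=> p [].
apply: within_continuous_subM.
  by apply: continuous_subspaceW sub _; case: bu => [[]].
apply: continuous_subspaceW sub _.
apply: (continuous_on_line (layer_cont Lv)).
apply: continuous_fctD; last exact: cst_continuous.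
exact: cone_coord_continuous.
Qed.

Lemma gap_subsol (k tau : R) (p : 'rV[R]_(m.+1 + m.+1) * R) :
  0 < k -> 0 < p.2 -> radius_t p.1 < radius_s p.1 ->
  subsol (1 - 2 * g) (gap k tau) p.
Proof.
move=> k0 p0 ts; have [su _] := bounded_extension_subsol bu.1 p0.
have [_ sv] := layer_subsol Lv (cone_coord p + tau) p0.
have vm x y : x <= y -> v (x, p.2) <= v (y, p.2).
  by move=> xy; apply: (layer_nondecreasing g01 Lv xy); exact: ltW.
have := subsolD su (subsolZ k0 (subsol_layer_of_cone vm ts sv)).
by under [X in subsol _ X]eq_fun do rewrite mulrN.
Qed.

(** Oddness gives v(0, l) = 0 at every height, and v is nondecreasing in x. *)
Lemma layer_ge0 (x l : R) : 0 <= x -> 0 <= l -> 0 <= v (x, l).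
Proof.
move=> x0 l0; have := v_odd 0 l0; rewrite oppr0 => v0.
by have := layer_nondecreasing g01 Lv x0 l0; lra.
Qed.

(** The maximum principle on one side of the cone: on the cone u = 0 and the layer is nonnegative,
    inside the gap is a subsolution, and u < 1 bounds it from above. *)
Lemma gap_le0 (k tau : R) : 0 < k -> 0 <= tau ->
  (forall x, radius_t x <= radius_s x -> gap k tau (x, 0) <= 0) ->
  forall p, cone_side p -> gap k tau p <= 0.
Proof.
move=> k0 tau0 H.
have le1 p : cone_side p -> gap k tau p <= 1.
  move=> [p0 ts]; have := u1 p0; rewrite ltr_norml => /andP[_ up].
  have := layer_ge0 (addr_ge0 (cone_coord_ge0 ts) tau0) p0.
  by move=> /(mulr_ge0 (ltW k0)); rewrite /gap; lra.
have sub : cone_side `<=` @closed_half_space R _ by move=> p [].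
apply: (phragmen_lindelof g01 closed_cone_side sub (gap_continuous (k:=k) (tau:=tau)) le1).
move=> [x l] [/=]; rewrite le_eqVlt => /predU1P[<- ts|l0].
  by left; exact: H.
rewrite le_eqVlt => /predU1P[ts|ts].
  left; rewrite /gap ucone ?(ltW l0)// sub0r oppr_le0 mulr_ge0 ?(ltW k0)//.
  by rewrite layer_ge0 ?(ltW l0)// addr_ge0// cone_coord_ge0//= ts.
by right; split => //; [exact: nbhs_cone_side|exact: gap_subsol].
Qed.

(** * The least admissible factor *)

Variables (K : R).
Hypothesis f_mul : forall k y : R, 1 < k -> 0 < y -> k * y <= 1 -> f (k * y) < k * f y.
Hypothesis f_cont : {within `[-1, 1], continuous f}.
Hypothesis f_lip : forall x y : R, -1 <= x -> x <= y -> y <= 1 -> `|f y - f x| <= K * (y - x).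

(** The deficit f(k y) - k f(y) degenerates at y = 0, so it is bounded away from 0 by compactness on
    [dl / 2, 1 / k] only; the Lipschitz bound carries this over to w close to k y. *)
Lemma nonlinearity_gap (k dl : R) : 1 < k -> 0 < dl -> dl <= 1 / k ->
  exists2 eta : R, 0 < eta & exists2 e0 : R, 0 < e0 &
    forall (w y : R), w <= k * y -> k * y - e0 < w -> w <= 1 -> dl <= y -> y <= 1 ->
      f w - k * f y <= - eta.
Proof.
move=> k1 dl0 dlk.
have k0 : 0 < k by lra.
pose phi y := f (k * y) - k * f y.
have K0 : 0 <= K.
  have := f_lip (x := 0) (y := 1); rewrite subr0 mulr1 => H.
  by apply: le_trans (H _ _ _); rewrite ?normr_ge0//; lra.
have cphi : {within `[dl / 2, 1 / k], continuous phi}.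
  apply: within_continuous_subM.
    apply: (continuous_within_comp f_cont).
      exact: mulrl_continuous.
    move=> t /=; rewrite !in_itv/= ler_pdivlMr// => /andP[t1 t2].
    by rewrite mulrC t2 andbT; apply: le_trans (_ : 0 <= _); [lra|nra].
  apply: continuous_subspaceW f_cont => t /=; rewrite !in_itv/= => /andP[t1 t2].
  have : 1 / k <= 1 by rewrite ler_pdivrMr//; lra.
  by move=> ?; apply/andP; split; lra.
have dk : dl / 2 <= 1 / k by lra.
have [z] := EVT_max dk cphi.
rewrite in_itv/= => /andP[z1 z2] Hz.
have phiz : phi z < 0.
  by rewrite subr_lt0; apply: f_mul => //; [lra|rewrite mulrC -ler_pdivlMr].
have kK : 0 < k * K + 1 by rewrite ltr_wpDl// mulr_ge0// ltW.
(* Half of the least deficit is kept and the other half covers the Lipschitz error; the bound dl / 2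
   on [e0] keeps w / k inside the compact interval. *)
exists (- phi z / 2); first by lra.
exists (Num.min (dl / 2) (- phi z / 2 / (k * K + 1))).
  by rewrite lt_min !divr_gt0//; lra.
move=> w y wy; rewrite ltrBlDr -ltrBlDl lt_min => /andP[e1 e2] w1 dly y1.
rewrite ltr_pdivlMr// in e2.
(* k y may exceed 1, where f carries no information; the deficit is therefore taken at w / k, which
   is at most both y and 1 / k. *)
pose y1' := w / k.
have wE : w = k * y1' by rewrite /y1'; field; lra.
have y1y : y1' <= y by rewrite /y1' ler_pdivrMr// mulrC.
have y1k : y1' <= 1 / k by rewrite ler_pM2r ?invr_gt0.
have ky : k * (y - y1') = k * y - w by rewrite mulrBr -wE.
have yd : dl / 2 <= y1'.
  have : y - y1' <= k * (y - y1') by rewrite ler_peMl ?subr_ge0// ltW.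
  lra.
have := Hz y1'; rewrite in_itv/= yd y1k => /(_ isT) P1.
have [L1 L2] : -1 <= y1' /\ y <= 1 by split; lra.
have := f_lip L1 y1y L2; rewrite ler_norml => /andP[lip _].
have E : f w - k * f y = phi y1' - k * (f y - f y1') by rewrite /phi -wE; ring.
have : k * (- (K * (y - y1'))) <= k * (f y - f y1') by rewrite ler_pM2l.
have KkK : K <= k * K by rewrite ler_peMl// ltW.
have : (k * y - w) * K <= (k * y - w) * (k * K + 1).
  by rewrite ler_wpM2l ?subr_ge0//; lra.
rewrite E -ky; rewrite -ky in e2; lra.
Qed.

(** If no smaller factor worked, k - eps would fail for every small eps > 0 and yield a boundary
    point where the gap exceeds - eps. At every almost contact in the box the fluxes make the gap
    rise like l^(2g), with a coefficient independent of eps, against [boundary_contact]. The upper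
    bound on k is what [nonlinearity_gap] requires of [dl]. *)
Lemma layer_factor_step (tau k : R) : 0 < tau -> 1 < k -> k <= (v (tau, 0))^-1 ->
  (forall x, radius_t x <= radius_s x -> gap k tau (x, 0) <= 0) ->
  exists2 k', k' < k & 1 <= k' /\
    (forall x, radius_t x <= radius_s x -> gap k' tau (x, 0) <= 0).
Proof.
move=> tau0 k1 kv H; apply: contrapT => noK.
have /andP[g0 g1] := g01.
have k0 : 0 < k by lra.
pose dl : R := v (tau, 0).
have dl0 : 0 < dl by have := layer_incr Lv tau0; rewrite (layer_at0 Lv).
have dlk : dl <= 1 / k by rewrite ler_pdivlMr// mulrC -ler_pdivlMr// mul1r.
have [eta eta0 [e0 e00 Heta]] := nonlinearity_gap k1 dl0 dlk.
have gd : 0 < 2 * g * d by rewrite !mulr_gt0.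
have dl20 : 0 < dl / 2 by lra.
(* Below height r, v(tau, l) > dl / 2, so on the cone, where u = 0, the gap is less than - dl / 2.
   The box size, and with it [M], is thus fixed before eps. *)
have [r r0 Hr] := on_line_trace_near tau (layer_cont Lv) dl20.
pose r2 := r / 2.
have r20 : 0 < r2 by rewrite divr_gt0.
(* Half of the coefficient given by the fluxes; the other half absorbs the error of the trace
   expansion. *)
pose et := eta / (2 * g * d) / 2.
have et0 : 0 < et by rewrite !divr_gt0.
pose M := (barrier_coef (m.+1 + m.+1) g + 1) / r2 `^ (2 * g).
have M0 : 0 < M.
  by rewrite divr_gt0 ?powR_gt0// addr_gt0// barrier_coef_gt0.
(* In this order: almost contacts avoid the cone; k - eps is still at least 1; [nonlinearity_gap]
   applies; 2 eps M <= et / 2, which contradicts the conclusion of [boundary_contact]. *)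
pose eps := Num.min (Num.min (dl / 2) (k - 1)) (Num.min e0 (et / (4 * M))).
have [eps0 e1 e2 e3 e4] : [/\ 0 < eps, eps <= dl / 2, eps <= k - 1, eps <= e0 &
    eps <= et / (4 * M)].
  split; rewrite /eps ?ge_min ?lexx ?orbT//.
  by rewrite !lt_min dl20 e00 subr_gt0 k1 divr_gt0// mulr_gt0.
have Gd (x : 'rV[R]_(m.+1 + m.+1)) : radius_t x <= radius_s x ->
    dl <= v (cone_coord (x, 0) + tau, 0).
  move=> ts; apply: (layer_nondecreasing g01 Lv) => //.
  by rewrite lerDr cone_coord_ge0.
have [x0 [ts0 Hx0]] : exists x, radius_t x <= radius_s x /\ - eps < gap k tau (x, 0).
  apply: contrapT => no; apply: noK; exists (k - eps); first by lra.
  split; first by lra.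
  move=> x ts; rewrite leNgt; apply/negP => Hx; apply: no; exists x; split => //.
  move: Hx; rewrite /gap/=; have /andP[_ G1] := layer_lt1 Lv (cone_coord (x, 0) + tau).
  have : eps * v (cone_coord (x, 0) + tau, 0) <= eps by rewrite ler_piMr// ltW.
  lra.
have Hle := gap_le0 k0 (ltW tau0) H.
have sub : cone_side `<=` @closed_half_space R _ by move=> p [].
have D0 : cone_side (x0, 0) by split => /=.
suff : et <= 2 * eps * M.
  rewrite ler_pdivlMr in e4; last by rewrite mulr_gt0.
  lra.
rewrite /M.
have bc := boundary_contact (eta := et) g01 r20 eps0 closed_cone_side sub
  (gap_continuous (k:=k) (tau:=tau)) Hle D0 Hx0.
apply: bc.
move=> [x l] [/= l0 ts] [_ /andP[_ /= lr]].
have [wle|wgt] : gap k tau (x, l) <= - eps \/ - eps < gap k tau (x, l).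
  by case: (lerP (gap k tau (x, l))); [left|right].
  by constructor 1.
move: l0; rewrite le_eqVlt => /predU1P[l0|l0]; last first.
  move: ts; rewrite le_eqVlt => /predU1P[ts|ts].
    constructor 1; rewrite /gap ucone ?(ltW l0)// sub0r lerN2.
    rewrite /cone_coord/= ts subrr mul0r add0r.
    have := Hr tau l; rewrite subrr normr0 r0 (ltW l0) (le_lt_trans lr) /r2; last lra.
    move=> /(_ isT isT); rewrite ltr_norml -/dl => /andP[_ A].
    have : 0 <= (k - 1) * v (tau, l) by rewrite mulr_ge0//; lra.
    lra.
  by constructor 2; split => //; [exact: nbhs_cone_side|exact: gap_subsol].
constructor 3; rewrite -l0 in wgt *; split => //.
have jt := trace_jetB k0 (bounded_solution_trace_jet x g0 d0 bu)
  (layer_trace Lv (cone_coord (x, 0) + tau)).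
have [dd dd0 Hdd] := jt _ et0.
exists dd => // t /andP[t0 td]; split; first by split => /=; [exact: ltW|].
have := Hdd t; rewrite t0 td => /(_ isT); rewrite ler_norml => /andP[+ _].
have gE s : gap k tau (x, s) = u (x, s) - k * v (cone_coord (x, 0) + tau, s) by [].
rewrite !gE; set C := (X in _ - X * _).
have CE : 2 * et <= C.
  have fw : f (u (x, 0)) - k * f (v (cone_coord (x, 0) + tau, 0)) <= - eta.
    have := H x ts; rewrite gE => w0; rewrite gE in wgt.
    have /andP[_ G1] := layer_lt1 Lv (cone_coord (x, 0) + tau).
    have := u1 (p := (x, 0)) (lexx 0); rewrite ltr_norml => /andP[_ ux].
    apply: Heta; [lra|lra|lra|exact: Gd|exact: ltW].
  have -> : 2 * et = eta / (2 * g * d) by rewrite /et; field; rewrite !gt_eqF.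
  have -> : C = - (f (u (x, 0)) - k * f (v (cone_coord (x, 0) + tau, 0))) / (2 * g * d).
    by rewrite /C; field; rewrite !gt_eqF.
  by rewrite ler_pM2r ?invr_gt0//; lra.
have P0 := powR_ge0 t (2 * g).
have : 2 * et * t `^ (2 * g) <= C * t `^ (2 * g) by rewrite ler_wpM2r.
lra.
Qed.

Lemma saddle_le_shifted_layer (tau : R) x : 0 < tau -> radius_t x <= radius_s x ->
  u (x, 0) <= v (cone_coord (x, 0) + tau, 0).
Proof.
move=> tau0 ts.
pose dl : R := v (tau, 0).
have dl0 : 0 < dl by have := layer_incr Lv tau0; rewrite (layer_at0 Lv).
have /andP[_ dl1] := layer_lt1 Lv tau; rewrite -/dl in dl1.
have Gd (y : 'rV[R]_(m.+1 + m.+1)) : radius_t y <= radius_s y ->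
    dl <= v (cone_coord (y, 0) + tau, 0).
  move=> tsy; apply: (layer_nondecreasing g01 Lv) => //.
  by rewrite lerDr cone_coord_ge0.
pose T : set R := [set k | 1 <= k /\
  forall y, radius_t y <= radius_s y -> gap k tau (y, 0) <= 0].
(* On l = 0 the shifted layer is at least [dl], so [dl^-1] times it is at least 1 > u. *)
have T1 : T dl^-1.
  split; first by rewrite invf_ge1// ltW.
  move=> y tsy; rewrite /gap/=.
  have := u1 (p := (y, 0)) (lexx 0); rewrite ltr_norml => /andP[_ uy].
  have : dl^-1 * dl <= dl^-1 * v (cone_coord (y, 0) + tau, 0).
    by rewrite ler_pM2l ?invr_gt0// Gd.
  by rewrite mulVf ?gt_eqF//; lra.
have infT : has_inf T by split; [exists dl^-1|exists 1 => k []].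
have s1 : 1 <= inf T by apply: lb_le_inf; [exists dl^-1|move=> k []].
have sT (y : 'rV[R]_(m.+1 + m.+1)) : radius_t y <= radius_s y -> gap (inf T) tau (y, 0) <= 0.
  move=> tsy; rewrite leNgt; apply/negP; rewrite /gap subr_gt0/=.
  have G0 := lt_le_trans dl0 (Gd y tsy).
  rewrite -ltr_pdivlMr// => lt; rewrite -subr_gt0 in lt.
  have [k [_ Hk]] := inf_adherent lt infT; rewrite addrC subrK => kl.
  have := Hk y tsy; rewrite /gap/= subr_le0 -ler_pdivrMr//; lra.
have [s1E|s1E] := eqVneq (inf T) 1.
  by have := sT x ts; rewrite s1E /gap/= mul1r subr_le0.
have sgt : 1 < inf T by rewrite lt_neqAle eq_sym s1E.
have sdl : inf T <= dl^-1 by apply: ge_inf => //; case: infT.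
have [k ks [k1 Hk]] := layer_factor_step tau0 sgt sdl sT.
have : inf T <= k by apply: ge_inf; [case: infT|split].
by lra.
Qed.

(** Continuity of the trace of v removes tau on l = 0, and the maximum principle with k = 1 and tau
    = 0 extends the inequality to l > 0. *)
Lemma saddle_le_layer (p : 'rV[R]_(m.+1 + m.+1) * R) : cone_side p ->
  u p <= v (cone_coord p, p.2).
Proof.
move=> Dp; have := gap_le0 ltr01 (lexx 0) _ Dp.
rewrite /gap mul1r addr0 subr_le0; apply => x ts.
rewrite mul1r addr0 subr_le0 leNgt; apply/negP => lt.
have e0 : 0 < u (x, 0) - v (cone_coord (x, 0), 0) by rewrite subr_gt0.
have [r r0 Hr] := on_line_trace_near (cone_coord (x, 0)) (layer_cont Lv) e0.
have r20 : 0 < r / 2 by rewrite divr_gt0.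
have := saddle_le_shifted_layer r20 ts.
have := Hr (cone_coord (x, 0) + r / 2) 0; rewrite lexx r0 => /(_ _ isT).
rewrite addrAC subrr add0r gtr0_norm// => /(_ _)-/(_ ltac:(lra)).
by rewrite ltr_norml; lra.
Qed.

End saddle.

(** * Both sides of the cone *)

Unset Implicit Arguments.

Theorem proposition1p5 (R : realType) (gamma alpha d_gamma : R) (m : nat)
    (f : R -> R) (u : 'rV[R]_(m + m) * R -> R) (u0 : R * R -> R)
    (hgamma : 0 < gamma < 1) (hd : extension_constant gamma d_gamma)
    (hm : (1 <= m)%N)
    (halpha : 0 < alpha < 1) (hf : C2alpha alpha f)
    (f_odd : forall x : R, -1 < x < 1 -> f (- x) = - f x)
    (f_at0 : f 0 = 0) (f_at1 : f 1 = 0)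
    (f_concave : forall x : R, 0 < x < 1 -> derive1n 2 f x < 0)
    (hu : saddle_solution gamma d_gamma f u)
    (hu0 : layer_solution gamma d_gamma f u0) :
  forall (x : 'rV[R]_(m + m)) (l : R), 0 <= l ->
    `|u (x, l)| <= `|layer_of_cone u0 (x, l)| /\
    `|layer_of_cone u0 (x, l)| = `|u0 (eucl_dist x (@simons_cone R m), l)|.
Proof.
case: m u hm hu => // m u _ [bu u1 urad uodd upos] x l l0.
have d0 : 0 < d_gamma by case: hd.
have g0 : 0 < gamma by case/andP: hgamma.
have [fc fd [K [fK _]]] := hf.
have Lv := layer_solution_layer g0 d0 hu0.
have [c c01 fdecr] := concave_decreasing_near1 fc fd f_at0 f_at1 f_concave.
have v_odd y s : 0 <= s -> u0 (- y, s) = - u0 (y, s).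
  exact: (layer_odd hgamma d0 f_odd c01 fdecr y Lv).
have ucone y s : 0 <= s -> radius_s y = radius_t y -> u (y, s) = 0.
  by move=> s0 st; have := uodd y y s s0 st (esym st); lra.
have fmul := concave_mul_lt fc fd f_at0 f_concave.
have flip y z := derivative_bound_lipschitz fc fd (x := y) (y := z)
  (fun t ht => let: And3 _ H _ := fK t ht in H).
have le_side := saddle_le_layer hgamma d0 bu u1 ucone Lv v_odd fmul fc flip.
have abs_side y : radius_t y <= radius_s y ->
    `|u (y, l)| <= `|u0 (cone_coord (y, l), l)|.
  move=> ts; have uv : u (y, l) <= u0 (cone_coord (y, l), l) by exact: le_side.
  have u_ge0 : 0 <= u (y, l).
    move: ts; rewrite le_eqVlt => /predU1P[ts|ts]; last by apply/ltW/upos.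
    by rewrite ucone.
  by rewrite !ger0_norm// (le_trans u_ge0).
split; last first.
  rewrite eucl_dist_cone /layer_of_cone/=.
  have [ts|ts] := lerP (radius_t x) (radius_s x).
    by [].
  by rewrite -[in RHS]opprB mulNr v_odd// normrN.
have [ts|ts] := lerP (radius_t x) (radius_s x); first exact: abs_side.
(* Exchanging x' and x'' moves the point to the side already treated; u and U both change sign. *)
pose y : 'rV[R]_(m.+1 + m.+1) := row_mx (rsubmx x) (lsubmx x).
have ys : radius_s y = radius_t x by rewrite /radius_s row_mxKl.
have yt : radius_t y = radius_s x by rewrite /radius_t row_mxKr.
have := abs_side y; rewrite ys yt => /(_ (ltW ts)).
rewrite (uodd y x l l0 ys yt) normrN /layer_of_cone /cone_coord/= ys yt.
by rewrite -opprB mulNr v_odd// normrN.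
Qed.
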